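(* Under the standing assumptions of the context, with the cyclic covering $(\mathbb B_j)_{0\le j\le m}$ of $\mathcal E_{\lambda_0}$, the WKB amplitudes $a_j$, and the transition symbols $\alpha_{j,j+1}(\hbar,\lambda)$ described there, the classical analytic symbol $$\mu(\hbar,\lambda):=\alpha_{0,1}(\hbar,\lambda)\,\alpha_{1,2}(\hbar,\lambda)\cdots\alpha_{m-1,m}(\hbar,\lambda)\,\alpha_{m,0}(\hbar,\lambda)$$ satisfies, for $\lambda$ near $\lambda_0$, $$\mu(\hbar,\lambda)=-1+\mathcal O(\hbar).$$
   Context: **Order function.** $\mathfrak m\in C^\infty(\mathbb R^2,(0,\infty))$ with $\liminf_{|X|\to\infty}\mathfrak m(X)>0$ and, for some $N,C$, $\mathfrak m(X)\le C\langle X-\widehat X\rangle^N\mathfrak m(\widehat X)$ on $\mathbb R^2\times\mathbb R^2$, $\langle(x,\xi)\rangle=(1+x^2+\xi^2)^{1/2}$; extended to $\mathbb C^2$ by $\mathfrak m(x,\xi):=\mathfrak m(\mathrm{Re}\,x,\mathrm{Re}\,\xi)$. **Standing assumptions.** $U_0$ is a tubular neighbourhood of $\mathbb R^2$ in $\mathbb C^2$ (open, $U_0\supset\mathbb R^2$, $U_0+\mathbb R^2=U_0$, $U_0\subset\mathbb R^2+\mathbb B_{\mathbb C^2}(0,r_0)$); $p$ is holomorphic on $U_0$, real on $\mathbb R^2$, $|p|\le C\mathfrak m$ on $U_0$. $E_1<E_2$ and for some $\delta>0$: (H.1) $p^{-1}((-\infty,E_2+\delta])\subset\mathbb R^2$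 is compact and nonempty; (H.2) $\nabla p\ne0$ on $p^{-1}((E_1-\delta,E_2+\delta))\subset\mathbb R^2$ and $E_\lambda=\{(x,\xi)\in\mathbb R^2:p=\lambda\}$ is nonempty and connected for $\lambda\in(E_1-\delta,E_2+\delta)$; (H.3) $\frac1{C_0}\mathfrak m\le C+\mathrm{Re}\,p\le C_0\mathfrak m$ on $U_0$ for some $C,C_0>0$. **Bargmann side.** $\Phi_0(z)=\frac12|z|^2$; $\kappa_0(x,\xi)=\frac1{\sqrt2}(x-i\xi,\xi-ix)$, mapping $\mathbb R^2$ onto $\Lambda_{\Phi_0}=\{(z,-i\bar z):z\in\mathbb C\}$; $p_{\Phi_0}=p\circ\kappa_0^{-1}$, i.e. $p_{\Phi_0}(z,\zeta)=p(\frac{z+i\zeta}{\sqrt2},\frac{\zeta+iz}{\sqrt2})$, holomorphic on $\kappa_0(U_0)$. $\mathcal E_\lambda=\kappa_0(E_\lambda)$ is identified with its projection on the $z$ variable. For a set $S\subset\mathbb C$, $L^2_{\Phi_0}(S)$ is the $L^2$ space with weight $e^{-2\Phi_0/\hbar}$. For $\lambda$ complex near $\lambda_0$ and $z$ near $\mathcal E_{\lambda_0}$, $\zeta(\lambda,z)$ is the holomorphic function with $p_{\Phi_0}(z,\zeta(\lambda,z))=\lambda$ and $\zeta(\lambda_0,z)=-i\bar z$ on $\mathcal E_{\lambda_0}$; $\partial_\zeta p_{\Phi_0}(z,\zeta(\lambda,z))\ne0$ there. For small $c,\delta'>0$, $$P_{c,\delta'}u(z)=\frac1{2\pi\hbar}\iint_{\Lambda_{c,\delta'}(z)}p_{\Phi_0}(\tfrac{z+w}2,\zeta)e^{\frac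 i\hbar\zeta(z-w)}u(w)\,d\zeta\wedge dw,$$ $\Lambda_{c,\delta'}(z)=\{(w,\zeta):|z-w|<\delta',\ \zeta=-\tfrac i2\overline{(z+w)}+ic\tfrac{\overline{z-w}}{\langle z-w\rangle}\}$, parametrized by $w$ and oriented so that $d\zeta\wedge dw$ is a positive multiple of Lebesgue measure at $w=z$ ($\langle z-w\rangle=(1+|z-w|^2)^{1/2}$). **Covering and WKB data.** $\lambda_0$ is in a small real neighbourhood of $[E_1,E_2]$ in $(E_1-\delta,E_2+\delta)$. $(\mathbb B_j)_{0\le j\le m}$ are small open discs in $\mathbb C$ centred at points of $\mathcal E_{\lambda_0}$ and covering $\mathcal E_{\lambda_0}$; indices are cyclic ($\mathbb B_{m+1}=\mathbb B_0$); $\mathbb B_j\cap\mathbb B_k=\emptyset$ iff $k\notin\{j-1,j,j+1\}$ cyclically; the Hamiltonian flow ($\dot x=\partial_\xi p$, $\dot\xi=-\partial_xp$, transported by $\kappa_0$) along $\mathcal E_{\lambda_0}$ crosses $\mathbb B_0,\mathbb B_1,\dots,\mathbb B_m$ and back to $\mathbb B_0$ in this order. $\Omega$ is a connected open set, relatively compact in $\bigcup_j\mathbb B_j$, and $K_j\subset\Omega\cap\mathbb B_j$ are compact with $\mathcal E_{\lambda_0}\subset\bigcup_jK_j$. $\Sigma_\hbar=N+i\hbar(-M,M)$ with $N$ a small real neighbourhood of $\lambda_0$, $M>0$. For real $\lambda$ near $\lambda_0$, $z_j(\lambda)\in\mathcal E_\lambda\cap\mathbb B_j$ depends smoothly on $\lambda$,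 and $z_j(\lambda):=z_j(\mathrm{Re}\,\lambda)$ for complex $\lambda$. On $\mathbb B_j$, $\varphi_j(\lambda,z)=\int_{z_j(\lambda)}^z\zeta(\lambda,w)\,dw-i\Phi_0(z_j(\lambda))$. $a_j(\hbar,\lambda,z)$ is a classical analytic symbol for $\lambda$ near $\lambda_0$, $z\in\mathbb B_j$, whose principal symbol satisfies $a_j^0(\lambda,z)^2=\partial_\zeta p_{\Phi_0}(z,\zeta(\lambda,z))^{-1}$ and such that, for small $\delta'$ and some $\mathscr C>0$, uniformly for $\lambda\in\Sigma_\hbar$, $\|(P_{c,\delta'}-\lambda)a_je^{\frac i\hbar\varphi_j}\|_{L^2_{\Phi_0}(K_j)}\le\mathcal O(e^{-\mathscr C/\hbar})\|a_je^{\frac i\hbar\varphi_j}\|_{L^2_{\Phi_0}(\mathbb B_j)}$ (these are the quasimodes built by analytic WKB). The $\alpha_{j,j+1}(\hbar,\lambda)$, $0\le j\le m$ (with $\alpha_{m,m+1}=\alpha_{m,0}$, $a_{m+1}=a_0$), are classical analytic symbols with principal symbol $\pm1$ such that, for $\lambda$ near $\lambda_0$, $\alpha_{j,j+1}a_{j+1}=a_j+\varepsilon_j$ on $\mathbb B_j\cap\mathbb B_{j+1}$ with $|\varepsilon_j|\le\mathcal O(e^{-\mathscr C/\hbar})$. **Classical analytic symbol.** On open $\Omega'\subset\mathbb C^d$: $a:(0,\hbar_0)\times\Omega'\to\mathbb C$, holomorphic on $\Omega'$ for each $\hbar$, with holomorphic $a_n$ such that for each compact $K$ there is $C_K>0$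 with $\sup_K|a_n|\le C_K^{n+1}n^n$ and $\sup_K|a(\hbar,\cdot)-\sum_{n<N}\hbar^na_n|\le\hbar^NC_K^{N+1}N^N$ for all $n,N,\hbar$; $a_0$ is its principal symbol. $\mathcal O(e^{-\mathscr C/\hbar})$ denotes a function of $\hbar$ bounded by $Re^{-\mathscr C/\hbar}$. *)

(* Defs.v *)
From HB Require Import structures.
From mathcomp Require Import all_boot all_order all_algebra.
From mathcomp Require Import all_classical all_reals all_analysis.
From mathcomp Require Import complex.

Set Implicit Arguments.
Unset Strict Implicit.
Unset Printing Implicit Defensive.

Import Order.TTheory GRing.Theory Num.Theory.
Import numFieldNormedType.Exports.

Local Open Scope classical_set_scope.
Local Open Scope ring_scope.
Local Open Scope complex_scope.

(* [R[i]] as a normed space over itself: [differentiable] between [R[i]]-normed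
   spaces is then complex (Frechet) differentiability. *)
HB.instance Definition _ (R : rcfType) := NormedModule.copy R[i] (R[i]^o).

Notation Re := complex.Re.
Notation Im := complex.Im.
Notation normc := Normc.normc.

Section ComplexAnalysis.
Variable R : realType.
Local Notation C := (R[i]).

Definition holomorphic_on (V : normedModType C) (D : set V) (f : V -> C) : Prop :=
  open D /\ forall x, D x -> differentiable f x.

Definition cexp (z : C) : C := (expR (Re z))%:C * (cos (Im z) +i* sin (Im z)).

Definition Cintegral d (T : measurableType d) (mu : {measure set T -> \bar R})
    (D : set T) (f : T -> C) : C :=
  Rintegral mu D (fun t => Re (f t)) +i* Rintegral mu D (fun t => Im (f t)).

Definition cderive1 (f : R -> C) (t : R) : C :=
  derive1 (fun s => Re (f s)) t +i* derive1 (fun s => Im (f s)) t.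

(* The complex plane is measured through its real coordinates. *)
Definition C_of (t : R * R) : C := t.1 +i* t.2.

Definition lebesgue2 := (@lebesgue_measure R \x @lebesgue_measure R)%E.

Definition segment_integral (a b : C) (f : C -> C) : C :=
  Cintegral (@lebesgue_measure R) `[0, 1]
    (fun t => f (a + t%:C * (b - a)) * (b - a)).

Definition smooth2 (f : R * R -> R) : Prop :=
  forall (s : seq (R * R)) (X : R * R),
    differentiable (foldr (fun v g => 'D_v g) f s) X.

Definition smooth_curve_on (D : set R) (f : R -> C) : Prop :=
  open D /\ forall n t, D t ->
    derivable (derive1n n (fun s => Re (f s))) t 1 /\
    derivable (derive1n n (fun s => Im (f s))) t 1.

End ComplexAnalysis.

Section ClassicalAnalyticSymbol.
Variable R : realType.
Local Notation C := (R[i]).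

(* [an] is the sequence of coefficients of [a]; it is determined by [a] on [D],
   and the principal symbol is [an 0]. Note that [0 ^+ 0 = 1]. *)
Definition analytic_symbol (V : normedModType C) (h0 : R) (D : set V)
    (a : R -> V -> C) (an : nat -> V -> C) : Prop :=
  [/\ forall h, 0 < h < h0 -> holomorphic_on D (a h),
      forall n, holomorphic_on D (an n)
    & forall K : set V, compact K -> K `<=` D ->
        exists CK : R, [/\ 0 < CK,
          forall n x, K x -> normc (an n x) <= CK ^+ n.+1 * n%:R ^+ n
        & forall N h x, 0 < h < h0 -> K x ->
            normc (a h x - \sum_(n < N) (h ^+ n)%:C * an n x)
              <= h ^+ N * CK ^+ N.+1 * N%:R ^+ N]].

End ClassicalAnalyticSymbol.

Section Hamiltonian.
Variable R : realType.
Local Notation C := (R[i]).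

Definition real_point (X : R * R) : C * C := (X.1%:C, X.2%:C).

Definition bracket2 (X : R * R) : R := Num.sqrt (1 + X.1 ^+ 2 + X.2 ^+ 2).

Definition infinity_filter2 : set (set (R * R)) :=
  [set V | exists A : R, forall X : R * R, A < `|X| -> V X].

Definition order_function (m : R * R -> R) : Prop :=
  [/\ smooth2 m, forall X, 0 < m X,
      (0 < limf_einf (fun X => (m X)%:E) infinity_filter2)%E
    & exists (N : nat) (A : R), forall X Y : R * R,
        m X <= A * bracket2 (X - Y) ^+ N * m Y].

Definition extend_order (m : R * R -> R) (X : C * C) : R := m (Re X.1, Re X.2).

Definition tubular_neighbourhood (U0 : set (C * C)) : Prop :=
  [/\ open U0, forall X, U0 (real_point X),
      [set X + real_point Y | X in U0 & Y in [set: R * R]] = U0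
    & exists r0 : R, 0 < r0 /\ forall X, U0 X -> exists Y : R * R,
        normc (X.1 - Y.1%:C) ^+ 2 + normc (X.2 - Y.2%:C) ^+ 2 < r0 ^+ 2].

Definition real_restriction (p : C * C -> C) (X : R * R) : R :=
  Re (p (real_point X)).

Definition dx (p : C * C -> C) (X : R * R) : R := 'D_(1, 0) (real_restriction p) X.
Definition dxi (p : C * C -> C) (X : R * R) : R := 'D_(0, 1) (real_restriction p) X.

Definition energy_level (p : C * C -> C) (lam : R) : set (R * R) :=
  [set X | real_restriction p X = lam].

Record standing_assumptions (m : R * R -> R) (U0 : set (C * C))
    (p : C * C -> C) (E1 E2 delta : R) : Prop := {
  sa_order : order_function m;
  sa_tube : tubular_neighbourhood U0;
  sa_holo : holomorphic_on U0 p;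
  sa_real : forall X, Im (p (real_point X)) = 0;
  sa_bound : exists A : R, forall X, U0 X -> normc (p X) <= A * extend_order m X;
  sa_E12 : E1 < E2;
  sa_delta : 0 < delta;
  sa_H1 : compact [set X | real_restriction p X <= E2 + delta] /\
          [set X | real_restriction p X <= E2 + delta] !=set0;
  sa_H2_gradient : forall X, E1 - delta < real_restriction p X < E2 + delta ->
          (dx p X, dxi p X) <> (0, 0);
  sa_H2_level : forall lam, E1 - delta < lam < E2 + delta ->
          energy_level p lam !=set0 /\ connected (energy_level p lam);
  sa_H3 : exists A C0 : R, [/\ 0 < A, 0 < C0 & forall X, U0 X ->
          C0^-1 * extend_order m X <= A + Re (p X) <= C0 * extend_order m X]
}.

End Hamiltonian.

Section Bargmann.
Variable R : realType.
Local Notation C := (R[i]).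

Definition rsqrt2 : C := (Num.sqrt 2)%:C.

Definition kappa0 (X : C * C) : C * C :=
  ((X.1 - 'i * X.2) / rsqrt2, (X.2 - 'i * X.1) / rsqrt2).

Definition kappa0_inv (Z : C * C) : C * C :=
  ((Z.1 + 'i * Z.2) / rsqrt2, (Z.2 + 'i * Z.1) / rsqrt2).

Definition Phi0 (z : C) : R := 2^-1 * normc z ^+ 2.

Definition p_Phi0 (p : C * C -> C) (Z : C * C) : C := p (kappa0_inv Z).

Definition dzeta_p_Phi0 (p : C * C -> C) (Z : C * C) : C := 'D_(0, 1) (p_Phi0 p) Z.

(* [kappa0] on a real point, projected on the variable z *)
Definition proj_z (X : R * R) : C := (kappa0 (real_point X)).1.

Definition curve (p : C * C -> C) (lam : R) : set C :=
  proj_z @` energy_level p lam.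

(* The L2 norm on [S] with weight exp(-2 Phi0 / h), as an extended real. *)
Definition L2Phi0 (h : R) (S : set C) (u : C -> C) : \bar R :=
  Lnorm (@lebesgue2 R) 2%:E (fun t : R * R =>
    (normc (u (C_of t)) * expR (- Phi0 (C_of t) / h) * \1_S (C_of t))%:E).

Definition contour (c : R) (z w : C) : C :=
  - ('i / 2) * (z + w)^* +
  'i * c%:C * (z - w)^* / (Num.sqrt (1 + normc (z - w) ^+ 2))%:C.

(* With w = s + i t one has
   dzeta /\ dw = (d_s zeta * d_t w - d_t zeta * d_s w) ds /\ dt
               = (i * d_s zeta - d_t zeta) ds /\ dt.
   Along [contour c z] this coefficient is 1 + 2 c > 0 at w = z, so that the
   prescribed orientation is the standard one, ds /\ dt. *)
Definition contour_density (c : R) (z w : C) : C :=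
  'i * cderive1 (fun s => contour c z (s +i* Im w)) (Re w)
     - cderive1 (fun t => contour c z (Re w +i* t)) (Im w).

Definition P_op (p : C * C -> C) (h c d : R) (u : C -> C) (z : C) : C :=
  ((2 * pi * h)^-1)%:C *
  Cintegral (@lebesgue2 R) [set t | normc (z - C_of t) < d] (fun t =>
    let w := C_of t in let zeta := contour c z w in
    p_Phi0 p ((z + w) / 2, zeta) * cexp ('i / h%:C * zeta * (z - w)) * u w *
    contour_density c z w).

(* [zeta (lam, z)] for lam in the neighbourhood [L] of lam0 and z in the
   neighbourhood [V] of the curve. *)
Record eikonal_solution (p : C * C -> C) (U0 : set (C * C)) (lam0 : R)
    (L V : set C) (zeta : C * C -> C) : Prop := {
  es_L : open L /\ L lam0%:C;
  es_V : open V /\ curve p lam0 `<=` V;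
  es_holo : holomorphic_on (L `*` V) zeta;
  es_dom : forall l z, L l -> V z -> (kappa0 @` U0) (z, zeta (l, z));
  es_eq : forall l z, L l -> V z -> p_Phi0 p (z, zeta (l, z)) = l;
  es_init : forall z, curve p lam0 z -> zeta (lam0%:C, z) = - 'i * z^*;
  es_nondeg : forall l z, L l -> V z -> dzeta_p_Phi0 p (z, zeta (l, z)) != 0
}.

End Bargmann.

Section Covering.
Variable R : realType.
Local Notation C := (R[i]).
Variable m : nat.

(* One turn of the Hamiltonian flow along the curve passes successively
   through B_0, B_1, ..., B_m and comes back to B_0: over one period
   [t 0, t m.+1] the projected trajectory lies in B_j for times in
   [t j, t j.+1]. *)
Definition flow_crosses (p : C * C -> C) (lam0 : R) (B : 'I_m.+1 -> set C) : Prop :=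
  exists (g : R -> R * R) (t : nat -> R),
  [/\ forall s, energy_level p lam0 (g s),
      forall s : R, is_derive s 1 (fun s => (g s).1) (dxi p (g s)) /\
                    is_derive s 1 (fun s => (g s).2) (- dx p (g s)),
      g (t m.+1) = g (t 0%N),
      forall s s', t 0%N <= s < t m.+1 -> t 0%N <= s' < t m.+1 ->
        g s = g s' -> s = s'
    & forall j : 'I_m.+1, t j < t j.+1 /\
        forall s, t j <= s <= t j.+1 -> B j (proj_z (g s))].

Definition disc (c : C) (r : R) : set C := ball c r%:C.

(* Indices are cyclic: [ordS] and [ord_pred] are successor and predecessor
   modulo m + 1. *)
Record cyclic_cover (p : C * C -> C) (lam0 : R) (ctr : 'I_m.+1 -> C)
    (rad : 'I_m.+1 -> R) : Prop := {
  cc_ctr : forall j, curve p lam0 (ctr j);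
  cc_rad : forall j, 0 < rad j;
  cc_cover : curve p lam0 `<=` \bigcup_j disc (ctr j) (rad j);
  cc_inter : forall j k,
    disc (ctr j) (rad j) `&` disc (ctr k) (rad k) = set0 <->
    ~ [\/ k = ord_pred j, k = j | k = ordS j];
  cc_flow : flow_crosses p lam0 (fun j => disc (ctr j) (rad j))
}.

Record inner_sets (p : C * C -> C) (lam0 : R) (B : 'I_m.+1 -> set C)
    (Omega : set C) (K : 'I_m.+1 -> set C) : Prop := {
  is_open : open Omega;
  is_connected : connected Omega;
  is_relcompact : compact (closure Omega) /\ closure Omega `<=` \bigcup_j B j;
  is_K_compact : forall j, compact (K j);
  is_K_sub : forall j, K j `<=` Omega `&` B j;
  is_K_cover : curve p lam0 `<=` \bigcup_j K j
}.

End Covering.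

Section WKB.
Variable R : realType.
Local Notation C := (R[i]).

Definition Sigma (N : set R) (M h : R) : set C :=
  [set l | N (Re l) /\ - (h * M) < Im l < h * M].

(* [zj] is the base point as a function of the real parameter. The path of
   integration is a segment inside a disc. *)
Definition phase (zeta : C * C -> C) (zj : R -> C) (l z : C) : C :=
  segment_integral (zj (Re l)) z (fun w => zeta (l, w)) -
  'i * (Phi0 (zj (Re l)))%:C.

Definition wkb (a : R -> C * C -> C) (phi : C -> C -> C) (h : R) (l z : C) : C :=
  a h (l, z) * cexp ('i / h%:C * phi l z).

Definition quasimode (p : C * C -> C) (h0 : R) (N : set R) (M : R)
    (K B : set C) (u : R -> C -> C -> C) : Prop :=
  exists2 c0 : R, 0 < c0 & forall c, 0 < c < c0 ->
  exists2 d0 : R, 0 < d0 & forall d, 0 < d < d0 ->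
  exists A CC : R, [/\ 0 < A, 0 < CC & forall h l, 0 < h < h0 -> Sigma N M h l ->
    (L2Phi0 h K (fun z => P_op p h c d (u h l) z - l * u h l z)%R <=
     (A * expR (- CC / h))%R%:E * L2Phi0 h B (u h l))%E].

End WKB.

(* Main.v *)
Require Import Defs.
From HB Require Import structures.
From mathcomp Require Import all_boot all_order all_algebra.
From mathcomp Require Import all_classical all_reals all_analysis.
From mathcomp Require Import complex ring lra.

Set Implicit Arguments.
Unset Strict Implicit.
Unset Printing Implicit Defensive.

Import Order.TTheory GRing.Theory Num.Theory.
Import numFieldNormedType.Exports.

Local Open Scope classical_set_scope.
Local Open Scope ring_scope.
Local Open Scope complex_scope.

(** The principal symbols of the transition functions are constant signs, so
    everything comes down to computing their product at [lam0], where it is a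
    monodromy.

    Letting [h] tend to 0 in the gluing relations at [lam0], the principal
    amplitudes satisfy [alpha_j a_(j+1) = a_j] on the overlaps: continuing the
    square root [a_0] of [1 / D], [D = d_zeta p], once around the curve along
    the chain of discs multiplies it by the product of the signs
    ([principal_transition], [inverse_tangent_sqrt_monodromy]). On the other
    hand [kappa0] is a symplectic change of variables, so that the Hamilton
    equations read [dz/ds = d_zeta p]: the function [D] evaluated along the
    trajectory is the velocity of the simple closed curve it describes
    ([dzeta_real_point]). By Hopf's Umlaufsatz the tangent of a simple closed
    curve turns exactly once, hence a continuous square root of the velocity
    changes sign after one turn. The product of the signs is therefore -1.

    Only the parity of the turning number matters, and it has a short proof
    ([tangent_sqrt_antiperiodic]). For a simple closed curve [g] on [[a, b]],
    the secant directions [g t - g s], suitably rescaled, extend to a continuous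
    nonvanishing function [F] on the triangle [a <= s <= t <= b], equal to the
    velocity on the diagonal. The triangle is contractible, so [F] has a
    continuous square root [f] ([star_shaped_sqrt]). Since the curve is closed,
    [F (s, b) = - F (a, s)]: there is one sign [e] with
    [f (s, b) = e i f (a, s)] for all [s]. Using this at [s = a] and at [s = b]
    gives [f (b, b) = (e i)^2 f (a, a) = - f (a, a)].

    The velocity is continuous because its inverse is the square of a
    holomorphic amplitude.

    Finally a product of classical analytic symbols is a classical analytic
    symbol, with the Cauchy products as coefficients ([analytic_symbolM]), and
    on a compact neighbourhood of [lam0] a symbol differs from its principal
    symbol by [O(h)] ([analytic_symbol_principal]). *)

Local Notation Re := complex.Re.
Local Notation Im := complex.Im.

(** * Real coordinates and topology of the complex numbers *)

Section ComplexTopology.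
Variable R : realType.
Local Notation C := R[i].
Implicit Types (z w : C) (x : R).

Lemma norm_normc z : `|z| = (normc z)%:C.
Proof. by []. Qed.

Lemma normc_ge0 z : 0 <= normc z.
Proof. by case: z => a b; exact: sqrtr_ge0. Qed.

Lemma normcR x : normc x%:C = `|x|.
Proof. by rewrite /normc /= expr0n addr0 sqrtr_sqr. Qed.

Lemma normc_distC z w : normc (z - w) = normc (w - z).
Proof. by rewrite -normcN opprB. Qed.

Lemma ReB z w : Re (z - w) = Re z - Re w. Proof. by case: z w => [? ?] []. Qed.

Lemma ImB z w : Im (z - w) = Im z - Im w. Proof. by case: z w => [? ?] []. Qed.

Lemma Re_scale x z : Re (x%:C * z) = x * Re z.
Proof. by case: z => u v /=; ring. Qed.

Lemma Im_scale x z : Im (x%:C * z) = x * Im z.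
Proof. by case: z => u v /=; ring. Qed.

Lemma normc_dist_dist z w : `|normc z - normc w| <= normc (z - w).
Proof.
have H (u v : C) : normc u <= normc v + normc (u - v).
  by rewrite -[X in normc X <= _](subrKC v) le_normcD.
have := H z w; have := H w z; rewrite (normc_distC w) ler_norml; lra.
Qed.

Lemma normc_Re z : `|Re z| <= normc z.
Proof. by rewrite -lecR -norm_normc normc_ge_Re. Qed.

Lemma normc_Im z : `|Im z| <= normc z.
Proof. by case: z => a b /=; rewrite -sqrtr_sqr ler_wsqrtr // lerDr sqr_ge0. Qed.

Lemma normc_le_ReIm z : normc z <= `|Re z| + `|Im z|.
Proof.
case: z => a b /=; have /le_trans := le_normcD a%:C ('i * b%:C).
have -> : a%:C + 'i * b%:C = a +i* b.
  by apply/eqP; rewrite eq_complex /=; apply/andP; split; apply/eqP; ring.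
apply.
by rewrite Normc.normcM !normcR /normc/= expr0n expr1n add0r sqrtr1 mul1r.
Qed.

(** The norm of [R[i]] takes values in [R[i]], and so do the radii of balls;
    this restates convergence with real radii. *)
Lemma cvgcP (T : Type) (F : set_system T) {FF : Filter F} (f : T -> C) (l : C) :
  f @ F --> l <-> forall e, 0 < e -> \forall t \near F, normc (l - f t) < e.
Proof.
split => [/cvgrPdist_lt fl e e0|fl].
  have e0' : 0 < e%:C by rewrite ltcR.
  by have := fl _ e0'; apply: filterS => t /=; rewrite norm_normc ltcR.
apply/cvgrPdist_lt => -[e i]; rewrite ltcE/= => /andP[/eqP-> e0].
by have := fl _ e0; apply: filterS => t; rewrite norm_normc ltcR.
Qed.

Lemma near_normc z e : 0 < e -> \forall w \near z, normc (z - w) < e.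
Proof.
move=> e0; apply: (@cvgcP _ (nbhs z) (nbhs_filter z) (fun w => w) z).1 e0.
exact: cvg_id.
Qed.

Lemma continuous_Re : continuous (@Re R : C -> R).
Proof.
move=> z; apply/(@cvgrPdist_lt _ _ _ (nbhs z) (nbhs_filter z)) => e e0.
have := near_normc z e0.
apply: (@filterS _ _ (nbhs_filter z)) => w; apply: le_lt_trans.
by rewrite -raddfB normc_Re.
Qed.

Lemma continuous_Im : continuous (@Im R : C -> R).
Proof.
move=> z; apply/(@cvgrPdist_lt _ _ _ (nbhs z) (nbhs_filter z)) => e e0.
have := near_normc z e0.
apply: (@filterS _ _ (nbhs_filter z)) => w; apply: le_lt_trans.
by rewrite -raddfB normc_Im.
Qed.

Lemma cvg_ReIm (T : Type) (F : set_system T) {FF : Filter F} (f g : T -> R) (a b : R) :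
  f @ F --> a -> g @ F --> b -> (fun t => f t +i* g t) @ F --> (a +i* b).
Proof.
move=> fa gb; apply/cvgcP => e e0.
have e20 : 0 < e / 2 by rewrite divr_gt0.
have /cvgrPdist_lt/(_ _ e20) fe := fa; have /cvgrPdist_lt/(_ _ e20) ge := gb.
near=> t; apply: le_lt_trans (normc_le_ReIm _) _ => /=.
rewrite (splitr e) ltrD //; near: t; [exact: fe | exact: ge].
Unshelve. all: by end_near. Qed.

Lemma continuous_normc : continuous (@normc R : C -> R).
Proof.
move=> z; apply/(@cvgrPdist_lt _ _ _ (nbhs z) (nbhs_filter z)) => e e0.
have := near_normc z e0.
apply: (@filterS _ _ (nbhs_filter z)) => w; apply: le_lt_trans.
exact: normc_dist_dist.
Qed.

Lemma continuous_real_complex : continuous (real_complex R : R -> C).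
Proof. by move=> x; apply: cvg_ReIm; [exact: cvg_id|exact: cvg_cst]. Qed.

Lemma continuous_C_of : continuous (@C_of R).
Proof. by move=> t; apply: cvg_ReIm; [exact: cvg_fst|exact: cvg_snd]. Qed.

Lemma nbhs_normcP z (A : set C) :
  nbhs z A <-> exists2 e, 0 < e & forall w, normc (z - w) < e -> A w.
Proof.
split=> [/nbhs_ballP [[e i]]|[e e0 zeA]]; last first.
  by have := near_normc z e0; apply: (@filterS _ _ (nbhs_filter z)) => w; exact: zeA.
rewrite /= ltcE /= => /andP[/eqP -> e0] zeA; exists e => // w zw; apply: zeA.
by rewrite -ball_normE /= norm_normc ltcR.
Qed.

Lemma compact_nbhs_complex z (A : set C) : nbhs z A ->
  exists K : set C, [/\ compact K, nbhs z K & K `<=` A].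
Proof.
move=> /nbhs_normcP[e e0 zeA]; set d := e / 3.
have d0 : 0 < d by rewrite divr_gt0.
(* a closed square, compact as the image of a real one *)
exists (@C_of R @` (`[Re z - d, Re z + d] `*` `[Im z - d, Im z + d])); split.
- apply: continuous_compact; last first.
    exact: compact_setX (@segment_compact _ _ _) (@segment_compact _ _ _).
  exact/continuous_subspaceT/continuous_C_of.
- apply/nbhs_normcP; exists d => // w zw; exists (Re w, Im w); last by case: (w).
  rewrite /= !in_itv /= -!ler_distlC -!raddfB; split.
    by rewrite (le_trans (normc_Re _)) // ltW.
  by rewrite (le_trans (normc_Im _)) // ltW.
- move=> _ [[x y] /= + <-]; rewrite !in_itv /= -!ler_distlC => -[zx zy].
  apply: zeA; apply: le_lt_trans (normc_le_ReIm _) _.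
  rewrite !raddfB /C_of /=; apply: le_lt_trans (lerD zx zy) _.
  by rewrite /d; lra.
Qed.

End ComplexTopology.

(** * Square roots on compact star-shaped sets *)

Section StarShapedSquareRoot.
Variable R : realType.
Local Notation C := R[i].
Implicit Types z w : C.

(** The half-angle formula for the principal root: [z + |z|] bisects the angle
    between [z] and the positive axis. *)
Definition half_plane_sqrt (z : C) : C :=
  (z + (normc z)%:C) / (Num.sqrt (2 * (Re z + normc z)))%:C.

Lemma half_plane_sqrtK z : 0 < Re z -> half_plane_sqrt z ^+ 2 = z.
Proof.
move=> z0; have s0 : 0 < 2 * (Re z + normc z).
  by rewrite mulr_gt0 // ltr_wpDr // normc_ge0.
rewrite expr_div_n -rmorphXn sqr_sqrtr ?ltW //.
apply/(canLR (mulfK _)).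
  by rewrite eq_complex /= eqxx andbT gt_eqF.
have : normc z ^+ 2 = Re z ^+ 2 + Im z ^+ 2.
  by case: (z) => a b /=; rewrite sqr_sqrtr ?addr_ge0 ?sqr_ge0.
case: z {z0 s0} => a b; set n := normc _ => /= nE.
have {}nE : n * n = a * a + b * b by rewrite -!expr2.
apply/eqP; rewrite eq_complex expr2 /=; apply/andP; split; apply/eqP; last by ring.
rewrite [LHS](_ : _ = a * a + 2 * n * a + n * n - b * b); last by ring.
by rewrite nE; ring.
Qed.

Lemma continuous_half_plane_sqrt z :
  0 < Re z -> {for z, continuous half_plane_sqrt}.
Proof.
move=> z0; have s0 : 0 < 2 * (Re z + normc z).
  by rewrite mulr_gt0 // ltr_wpDr // normc_ge0.
have cn := @continuous_normc R z.
have cR : continuous_at z (fun w => Num.sqrt (2 * (Re w + normc w))).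
  apply: continuous_comp; last exact: sqrt_continuous.
  apply: (@cvgM _ _ _ (nbhs_filter z)); first exact: cvg_cst.
  by apply: (@cvgD _ _ _ _ (nbhs_filter z)) => //; exact: continuous_Re.
apply: (@cvgM _ _ _ (nbhs_filter z)).
  apply: (@cvgD _ _ _ _ (nbhs_filter z)); first exact: cvg_id.
  exact: (continuous_comp cn (@continuous_real_complex _ _)).
apply: (@cvgV _ _ _ (nbhs_filter z)).
  by rewrite eq_complex /= eqxx andbT gt_eqF // sqrtr_gt0.
exact: (continuous_comp cR (@continuous_real_complex _ _)).
Qed.

(** Uniform continuity measured against the values of [F], by a Lebesgue
    number argument: nearby values have a quotient close to 1, hence in the
    right half-plane. *)
Lemma uniformly_nonzero (V : normedModType R) (K : set V) (F : V -> C) :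
  compact K -> {within K, continuous F} -> (forall x, K x -> F x != 0) ->
  exists2 d, 0 < d & forall x y, K x -> K y -> `|x - y| < d ->
    normc (F x - F y) < normc (F x).
Proof.
move=> /compact_near_coveringP/near_covering_withinP cK.
move=> /subspace_continuousP cF F0.
pose P (d : R) x := forall y, K y -> `|x - y| < d -> normc (F x - F y) < normc (F x).
have : \forall d \near 0^'+, K `<=` P d.
  apply: cK => x Kx.
  have e0 : 0 < normc (F x) / 3.
    rewrite divr_gt0 // lt_neqAle normc_ge0 andbT eq_sym.
    by apply: contra (F0 _ Kx) => /eqP/Normc.eq0_normc ->.
  have /cvgcP/(_ _ e0)/nbhs_ballP[r /= r0 xr] := cF _ Kx.
  have r20 : 0 < r / 2 by rewrite divr_gt0.
  near=> x' d => Kx' y Ky x'y.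
  have xx' : `|x - x'| < r / 2.
    by near: x'; apply/nbhs_ballP; exists (r / 2) => //= z; rewrite -ball_normE.
  have dr : d < r / 2 by near: d; exact: nbhs_right_lt.
  have Fx' : normc (F x - F x') < normc (F x) / 3.
    apply: xr => //; rewrite -ball_normE /= (lt_trans xx') //; lra.
  have Fy : normc (F x - F y) < normc (F x) / 3.
    apply: xr => //; rewrite -ball_normE /=.
    rewrite (le_lt_trans (ler_distD x' _ _)) // (splitr r) ltrD //.
    exact: lt_trans dr.
  have := le_normcD (F x' - F x) (F x - F y); rewrite addrA subrK normc_distC.
  have := normc_dist_dist (F x) (F x'); rewrite ler_norml; lra.
move=> nP; near ((0 : R)^'+) => d.
have Pd : K `<=` P d by near: d.
exists d; first by near: d; exact: nbhs_right_gt.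
by move=> x y Kx Ky; exact: Pd.
Unshelve. all: by end_near. Qed.

Lemma within_continuous_compW (S T U : topologicalType) (A : set S) (B : set T)
    (f : S -> T) (g : T -> U) :
  continuous f -> (forall x, A x -> B (f x)) -> {within B, continuous g} ->
  {within A, continuous (g \o f)}.
Proof.
move=> cf AB /subspace_continuousP cg; apply/subspace_continuousP => x Ax.
apply: cvg_comp (cg _ (AB _ Ax)) => P /= nP.
have := cf x _ nP; rewrite /= /nbhs/= /within /=.
by apply: filterS => y fyP Ay; apply: fyP; exact: AB.
Qed.

(** Going from the centre to [x] in [n] equal steps, [F x] is [F x0] times the
    product of the quotients of consecutive values. For a uniformly large [n]
    all the quotients lie in the right half-plane, where the principal root is
    continuous, so the product of their roots depends continuously on [x]. *)
Lemma star_shaped_sqrt (V : normedModType R) (K : set V) (x0 : V) (F : V -> C) :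
  compact K -> K x0 ->
  (forall x t, K x -> 0 <= t <= 1 -> K (x0 + t *: (x - x0))) ->
  {within K, continuous F} -> (forall x, K x -> F x != 0) ->
  exists2 b : V -> C, {within K, continuous b} & forall x, K x -> b x ^+ 2 = F x.
Proof.
move=> cK Kx0 star cF F0; have [d d0 Fd] := uniformly_nonzero cK cF F0.
have [M M0 KM] : exists2 M, 0 < M & forall x, K x -> `|x - x0| <= M.
  have [r Kr] := (@ex_bound _ _ _ id (globally K)
    (globally_properfilter Kx0)).1 (compact_bounded cK).
  exists (Num.max 1 (r + `|x0|)); first by rewrite lt_max ltr01.
  move=> x Kx; rewrite le_max; apply/orP; right.
  by rewrite (le_trans (ler_normB _ _)) // lerD2r Kr.
set n := Num.truncn (M / d).
have nM : M / d < n.+1%:R by apply: truncnS_gt.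
pose p k x := x0 + (k%:R / n.+1%:R) *: (x - x0).
have Kp k x : (k <= n.+1)%N -> K x -> K (p k x).
  move=> kn Kx; apply: star => //.
  by rewrite divr_ge0 //= ler_pdivrMr // mul1r ler_nat.
pose q k x := F (p k.+1 x) / F (p k x).
have q0 k x : (k < n.+1)%N -> K x -> 0 < Re (q k x).
  move=> kn Kx; have Kpk := Kp _ _ (ltnW kn) Kx; have Kpk1 := Kp _ _ kn Kx.
  have pk : `|p k x - p k.+1 x| < d.
    rewrite distrC /p opprD addrACA subrr add0r -scalerBl normrZ -mulrBl -natrB //.
    rewrite subSnn mul1r gtr0_norm ?invr_gt0 // mulrC ltr_pdivrMr //.
    by rewrite (le_lt_trans (KM _ Kx)) // -ltr_pdivrMl // mulrC.
  have Fpk0 := F0 _ Kpk.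
  have : normc (1 - q k x) < 1.
    rewrite -(divff Fpk0) -mulrBl Normc.normcM Normc.normcV.
    rewrite ltr_pdivrMr ?mul1r ?Fd // lt_neqAle normc_ge0 andbT eq_sym.
    by apply: contra Fpk0 => /eqP/Normc.eq0_normc ->.
  move/(le_lt_trans (normc_Re _)); rewrite raddfB /= ltr_norml; lra.
have cp k : continuous (p k).
  move=> x; apply: cvgD; first exact: cvg_cst.
  by apply: cvgZl_tmp; apply: cvgB; [exact: cvg_id|exact: cvg_cst].
have cFp k : (k <= n.+1)%N -> {within K, continuous (F \o p k)}.
  by move=> kn; apply: within_continuous_compW cF => // x; exact: Kp.
have cq k x : (k < n.+1)%N -> K x -> q k y @[y --> within K (nbhs x)] --> q k x.
  move=> kn Kx.
  have cFpx j : (j <= n.+1)%N -> F (p j y) @[y --> within K (nbhs x)] --> F (p j x).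
    by move=> /cFp/subspace_continuousP/(_ _ Kx).
  apply: (cvgM (cFpx _ kn)); apply: cvgV; last exact: cFpx (ltnW kn).
  exact: F0 (Kp _ _ (ltnW kn) Kx).
exists (fun x => sqrtC (F x0) * \prod_(k < n.+1) half_plane_sqrt (q k x)).
  apply/subspace_continuousP => x Kx.
  apply: cvgM; first exact: cvg_cst.
  apply: cvg_big => [|i _]; first exact: mul_continuous.
  apply: (cvg_comp _ half_plane_sqrt (cq i x (ltn_ord i) Kx)).
  exact: continuous_half_plane_sqrt (q0 i x (ltn_ord i) Kx).
move=> x Kx; rewrite exprMn sqrtCK -prodrXl.
under eq_bigr do rewrite half_plane_sqrtK ?q0 //.
rewrite -(big_mkord xpredT (q ^~ x)) (@telescope_prodf _ 0 n.+1 (fun k => F (p k x))) //.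
  rewrite {2}/p mul0r scale0r addr0 /p divff // scale1r addrC subrK.
  by rewrite mulrCA divff ?mulr1 //; exact: F0.
by move=> k /andP[_ kn]; apply: F0; apply: Kp => //; exact: ltnW.
Qed.

End StarShapedSquareRoot.

(** * The turning number of a simple closed curve is odd *)

Section TurningNumber.
Variable R : realType.
Local Notation C := R[i].

Lemma sign_constant (a b : R) (f : R -> C) : a <= b ->
  {within `[a, b], continuous f} -> (forall s, a <= s <= b -> f s ^+ 2 = 1) ->
  f a = f b.
Proof.
move=> ab cf f1.
have cRf : {within `[a, b], continuous (fun s => Re (f s))}.
  apply: (@within_continuous_comp _ _ _ _ f (@Re R : C -> R)) => //.
  by move=> z _; exact: continuous_Re.
have sgn s : a <= s <= b -> f s = 1 \/ f s = -1.
  by move=> /f1/eqP; rewrite sqrf_eq1 => /orP[]/eqP; [left|right].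
have Re0 : Re (f a) <> - Re (f b).
  move=> fab; have [|c] := @IVT _ _ _ _ 0 ab cRf.
    by rewrite ge_min le_max fab oppr_le0 oppr_ge0 orbC andbb le_total.
  rewrite in_itv /= => /sgn[] -> /=; lra.
have [ha hb] : a <= a <= b /\ a <= b <= b by rewrite !lexx ab.
by case: (sgn _ ha) Re0 => ->; case: (sgn _ hb) => -> //= []; rewrite ?opprK.
Qed.

Definition triangle (a b : R) : set (R * R) :=
  [set x | a <= x.1 /\ x.1 <= x.2 /\ x.2 <= b].

Lemma compact_triangle a b : compact (triangle a b).
Proof.
apply: (@subclosed_compact _ _ (`[a, b] `*` `[a, b])).
- have cB : closed [set x : R * R | 0 <= x.2 - x.1].
    apply: ((continuous_closedP (fun x : R * R => x.2 - x.1)).1 _ _ (@closed_ge _ 0)) => x.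
    by apply: cvgB; [exact: cvg_snd|exact: cvg_fst].
  have cA : closed [set x : R * R | a <= x.1].
    by apply: ((continuous_closedP (@fst R R)).1 _ _ (@closed_ge _ a)) => x; exact: cvg_fst.
  have cC : closed [set x : R * R | x.2 <= b].
    by apply: ((continuous_closedP (@snd R R)).1 _ _ (@closed_le _ b)) => x; exact: cvg_snd.
  rewrite (_ : triangle a b = [set x : R * R | a <= x.1] `&`
    ([set x : R * R | 0 <= x.2 - x.1] `&` [set x : R * R | x.2 <= b])).
    by apply: closedI => //; exact: closedI.
  by apply/seteqP; split => x /=; rewrite /triangle /= subr_ge0.
- exact: compact_setX (@segment_compact _ _ _) (@segment_compact _ _ _).
- move=> [x y] [/= ax [xy yb]]; by rewrite !in_itv /=; split; apply/andP; split; lra.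
Qed.

Lemma continuous_curve (g D : R -> C) :
  (forall s : R, is_derive s 1 (fun s => Re (g s)) (Re (D s))) ->
  (forall s : R, is_derive s 1 (fun s => Im (g s)) (Im (D s))) ->
  continuous g.
Proof.
move=> dRe dIm.
have cr (f df : R -> R) : (forall s : R, is_derive s 1 f (df s)) -> continuous f.
  move=> df' s; apply: differentiable_continuous; apply/derivable1_diffP.
  by have [] := df' s.
move=> s; rewrite /continuous_at [g s](_ : _ = Re (g s) +i* Im (g s)); last by case: (g s).
rewrite (_ : g = fun s => Re (g s) +i* Im (g s)); last by apply/funext => ?; case: (g _).
by apply: cvg_ReIm; [exact: (cr _ _ dRe)|exact: (cr _ _ dIm)].
Qed.

Lemma quotient_sub (u : R) (z v : C) : u != 0 ->
  z * (u^-1)%:C - v = (z - u%:C * v) * (u^-1)%:C.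
Proof.
by move=> u0; rewrite mulrBl mulrAC -[_%:C * _%:C]rmorphM divff // mul1r.
Qed.

Section Secants.
Variables (a b : R) (g D : R -> C).
Hypothesis ab : a < b.
Hypothesis dRe : forall s : R, is_derive s 1 (fun s => Re (g s)) (Re (D s)).
Hypothesis dIm : forall s : R, is_derive s 1 (fun s => Im (g s)) (Im (D s)).
Hypothesis cD : continuous D.
Hypothesis D_neq0 : forall s, D s != 0.
Hypothesis g_closed : g a = g b.
Hypothesis D_closed : D a = D b.
Hypothesis g_simple : forall s t, a <= s < b -> a <= t < b -> g s = g t -> s = t.

Let continuous_g : continuous g.
Proof. exact: continuous_curve dRe dIm. Qed.

(** The mean value inequality, obtained on the two real components separately:
    the mean value theorem does not hold for complex values. *)
Let chord (s0 e : R) : 0 < e -> exists2 d, 0 < d & forall s t, s <= t ->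
  `|s0 - s| < d -> `|s0 - t| < d ->
  normc (g t - g s - (t - s)%:C * D s0) <= e * (t - s).
Proof.
move=> e0; have e20 : 0 < e / 2 by rewrite divr_gt0.
have /nbhs_ballP[d /= d0 Dd] :=
  (@cvgcP _ _ (nbhs s0) (nbhs_filter s0) D (D s0)).1 (@cD s0) _ e20.
exists d => // s t st s0s s0t.
have near_D (x : R) : s <= x <= t -> normc (D x - D s0) < e / 2.
  move=> sxt; rewrite normc_distC; apply: Dd; rewrite -ball_normE /=.
  by move: s0s s0t; rewrite !ltr_norml; lra.
have mv (f df : R -> R) : (forall s : R, is_derive s 1 f (df s)) ->
    exists2 x, s <= x <= t & f t - f s = df x * (t - s).
  move=> dfE; have cf : {within `[s, t], continuous f}.
    by apply: derivable_within_continuous => x _; case: (dfE x).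
  have [x xst] := @MVT_segment _ f df s t st (fun x _ => dfE x) cf.
  by exists x => //; rewrite in_itv in xst.
have [x xst gx] := mv _ _ (@dRe); have [y yst gy] := mv _ _ (@dIm).
apply: le_trans (normc_le_ReIm _) _.
have -> : Re (g t - g s - (t - s)%:C * D s0) = Re (D x - D s0) * (t - s).
  by rewrite !ReB Re_scale gx; ring.
have -> : Im (g t - g s - (t - s)%:C * D s0) = Im (D y - D s0) * (t - s).
  by rewrite !ImB Im_scale gy; ring.
rewrite !normrM (ger0_norm (_ : 0 <= t - s)) ?subr_ge0 // -mulrDl ler_wpM2r ?subr_ge0 //.
have := normc_Re (D x - D s0); have := normc_Im (D y - D s0).
by have := near_D _ xst; have := near_D _ yst; lra.
Qed.

(** With [l = b - a] and [u = x.2 - x.1], the chord is divided by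
    [u * (l - u) / l], which vanishes to first order at both configurations
    where the chord of a closed curve degenerates: the diagonal and the corner
    [(a, b)]. The first two branches are the limits there. *)
Definition secant (x : R * R) : C :=
  if x.1 == x.2 then D x.1
  else if (x.1 == a) && (x.2 == b) then - D a
  else (g x.2 - g x.1) * ((b - a) / ((x.2 - x.1) * (b - a - (x.2 - x.1))))%:C.

Local Notation K := (triangle a b).

Let fst_cvg (x0 : R * R) : (fun x : R * R => x.1) @ within K (nbhs x0) --> x0.1.
Proof. by apply: cvg_within_filter; exact: cvg_fst. Qed.

Let snd_cvg (x0 : R * R) : (fun x : R * R => x.2) @ within K (nbhs x0) --> x0.2.
Proof. by apply: cvg_within_filter; exact: cvg_snd. Qed.

Let gap_cvg (x0 : R * R) : (fun x : R * R => x.2 - x.1) @ within K (nbhs x0) --> x0.2 - x0.1.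
Proof. by apply: cvgB; [exact: snd_cvg|exact: fst_cvg]. Qed.

Let K_near (x0 : R * R) : within K (nbhs x0) K.
Proof. exact: withinT. Qed.

Let secant_diagonal s : secant @ within K (nbhs (s, s)) --> D s.
Proof.
pose slope (x : R * R) : C := if x.1 == x.2 then D x.1
  else (g x.2 - g x.1) * ((x.2 - x.1)^-1)%:C.
have slope_cvg : slope @ within K (nbhs (s, s)) --> D s.
  apply/cvgcP => e e0; have [|d d0 gd] := @chord s (e / 2); first by rewrite divr_gt0.
  near=> x; have [_ [x12 _]] : K x by near: x; exact: K_near.
  have x1 : `|s - x.1| < d.
    by near: x; exact: (cvgr_dist_lt _ _ (@fst_cvg (s, s)) _ d0).
  have x2 : `|s - x.2| < d.
    by near: x; exact: (cvgr_dist_lt _ _ (@snd_cvg (s, s)) _ d0).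
  rewrite /slope; case: eqVneq => [_|x12n].
    near: x; apply: (cvgcP _ _).1 e0.
    exact: (cvg_comp _ _ (@fst_cvg (s, s)) (@cD s)).
  have h0 : 0 < x.2 - x.1 by rewrite subr_gt0 lt_neqAle x12n.
  rewrite normc_distC.
  rewrite quotient_sub ?gt_eqF //.
  rewrite Normc.normcM normcR gtr0_norm ?invr_gt0 // ltr_pdivrMr //.
  apply: le_lt_trans (gd _ _ x12 x1 x2) _; rewrite ltr_pM2r //; lra.
have l0 : b - a != 0 by rewrite subr_eq0 gt_eqF.
have ratio : (fun x : R * R => ((b - a) / (b - a - (x.2 - x.1)))%:C)
    @ within K (nbhs (s, s)) --> (1 : C).
  have : (fun x : R * R => (b - a) / (b - a - (x.2 - x.1))) @ within K (nbhs (s, s))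
      --> (b - a) / (b - a - (s - s)).
    apply: cvgM; first exact: cvg_cst.
    apply: cvgV; first by rewrite subrr subr0.
    by apply: cvgB; [exact: cvg_cst|exact: (@gap_cvg (s, s))].
  rewrite subrr subr0 (divff l0) => H; exact: (cvg_comp _ _ H (@continuous_real_complex R _)).
rewrite -[D s]mulr1; apply: cvg_trans (cvgM slope_cvg ratio).
have s0 : (s, s).2 - (s, s).1 < b - a by rewrite /= subrr subr_gt0.
apply: near_eq_cvg; near=> x; rewrite /secant /slope /=.
have x12 : x.2 - x.1 < b - a.
  by near: x; exact: (cvgr_lt _ (@gap_cvg (s, s)) _ s0).
case: eqVneq => [->|x12n]; first by rewrite subrr subr0 divff ?mulr1 // subr_eq0 gt_eqF.
have -> : (x.1 == a) && (x.2 == b) = false.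
  by apply/negP => /andP[/eqP xa /eqP xb]; move: x12; rewrite xa xb ltxx.
rewrite -mulrA -rmorphM /=; congr (_ * _%:C).
by rewrite invfM mulrCA.
Unshelve. all: by end_near. Qed.

(** Near the corner the chord is, up to sign, the sum of the short displacement
    from [g a] to [g x.1] and of that from [g x.2] to [g b]; both have nearly
    the direction [D a = D b]. *)
Let secant_corner : secant @ within K (nbhs (a, b)) --> - D a.
Proof.
pose slope (x : R * R) : C := if (x.1 == a) && (x.2 == b) then D a
  else (g x.1 - g a + (g b - g x.2)) * (((x.1 - a) + (b - x.2))^-1)%:C.
have slope_cvg : slope @ within K (nbhs (a, b)) --> D a.
  apply/cvgcP => e e0.
  have [|d d0 ga] := @chord a (e / 2); first by rewrite divr_gt0.
  have [|d' d'0 gb] := @chord b (e / 2); first by rewrite divr_gt0.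
  near=> x; have [ax [_ xb]] : K x by near: x; exact: K_near.
  have x1 : `|a - x.1| < d.
    by near: x; exact: (cvgr_dist_lt _ _ (@fst_cvg (a, b)) _ d0).
  have x2 : `|b - x.2| < d'.
    by near: x; exact: (cvgr_dist_lt _ _ (@snd_cvg (a, b)) _ d'0).
  rewrite /slope; case: ifPn => [_|corner]; first by rewrite subrr Normc.normc0.
  have h0 : 0 < (x.1 - a) + (b - x.2).
    rewrite lt_neqAle addr_ge0 ?subr_ge0 // andbT eq_sym paddr_eq0 ?subr_ge0 //.
    by rewrite !subr_eq0 (eq_sym b).
  rewrite normc_distC.
  have uD : (x.1 - a + (b - x.2))%:C * D a =
      (x.1 - a)%:C * D a + (b - x.2)%:C * D b.
    by rewrite -D_closed -mulrDl rmorphD.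
  rewrite quotient_sub ?gt_eqF // uD opprD addrACA.
  rewrite Normc.normcM normcR gtr0_norm ?invr_gt0 // ltr_pdivrMr //.
  apply: le_lt_trans (le_normcD _ _) _.
  have := ga _ _ ax _ x1; rewrite subrr normr0 => /(_ d0).
  have := gb _ _ xb x2; rewrite subrr normr0 => /(_ d'0).
  have : e / 2 * (x.1 - a + (b - x.2)) < e * (x.1 - a + (b - x.2)) by rewrite ltr_pM2r //; lra.
  lra.
have l0 : b - a != 0 by rewrite subr_eq0 gt_eqF.
have ratio : (fun x : R * R => - ((b - a) / (x.2 - x.1))%:C)
    @ within K (nbhs (a, b)) --> (- 1 : C).
  apply: cvgN.
  have : (fun x : R * R => (b - a) / (x.2 - x.1)) @ within K (nbhs (a, b)) --> (b - a) / (b - a).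
    apply: cvgM; first exact: cvg_cst.
    by apply: cvgV; [|exact: (@gap_cvg (a, b))].
  rewrite (divff l0) => H; exact: (cvg_comp _ _ H (@continuous_real_complex R _)).
rewrite -mulrN1; apply: cvg_trans (cvgM slope_cvg ratio).
have ab0 : 0 < (a, b).2 - (a, b).1 by rewrite subr_gt0.
apply: near_eq_cvg; near=> x; rewrite /secant /slope /=.
have x12 : 0 < x.2 - x.1.
  by near: x; exact: (cvgr_gt _ (@gap_cvg (a, b)) _ ab0).
have -> : (x.1 == x.2) = false by rewrite lt_eqF // -subr_gt0.
case: ifPn => [/andP[/eqP-> /eqP->]|corner]; first by rewrite divff ?mulrN1 // subr_eq0 gt_eqF.
have -> : g x.2 - g x.1 = - (g x.1 - g a + (g b - g x.2)).
  by rewrite g_closed; ring.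
rewrite mulrN !mulNr; congr (- _); rewrite -mulrA -rmorphM /=; congr (_ * _%:C).
have -> : b - a - (x.2 - x.1) = x.1 - a + (b - x.2) by ring.
by rewrite invfM mulrCA [_^-1 * _^-1 in RHS]mulrC.
Unshelve. all: by end_near. Qed.

Lemma continuous_secant : {within K, continuous secant}.
Proof.
apply/subspace_continuousP => -[s t] [/= a_s [st tb]].
rewrite -[secant @ _ --> _]/(secant @ within K (nbhs (s, t)) --> secant (s, t)).
case: (eqVneq s t) => [<-|st0].
  by rewrite [secant (s, s)]/secant /= eqxx; exact: secant_diagonal.
case: (boolP ((s == a) && (t == b))) => [/andP[/eqP -> /eqP ->]|corner].
  by rewrite [secant (a, b)]/secant /= (lt_eqF ab) !eqxx; exact: secant_corner.
have st1 : 0 < (s, t).2 - (s, t).1 by rewrite subr_gt0 lt_neqAle st0.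
have st2 : (s, t).2 - (s, t).1 < b - a.
  rewrite /= ltNge; apply: contra corner => h.
  by apply/andP; split; rewrite eq_le; apply/andP; split; lra.
have -> : secant (s, t) = (g t - g s) * ((b - a) / ((t - s) * (b - a - (t - s))))%:C.
  by rewrite /secant /= (negbTE st0) (negbTE corner).
have F : (fun x : R * R => (g x.2 - g x.1) *
    ((b - a) / ((x.2 - x.1) * (b - a - (x.2 - x.1))))%:C) @ within K (nbhs (s, t)) -->
    (g t - g s) * ((b - a) / ((t - s) * (b - a - (t - s))))%:C.
  have cg x0 : g y @[y --> x0] --> g x0 by exact: continuous_g.
  apply: cvgM.
    apply: cvgB; [exact: (cvg_comp _ _ (@snd_cvg (s, t)) (cg t))|].
    exact: (cvg_comp _ _ (@fst_cvg (s, t)) (cg s)).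
  have : (fun x : R * R => (b - a) / ((x.2 - x.1) * (b - a - (x.2 - x.1))))
      @ within K (nbhs (s, t)) --> (b - a) / ((t - s) * (b - a - (t - s))).
    apply: cvgM; first exact: cvg_cst.
    apply: cvgV; first by rewrite mulf_neq0 // gt_eqF // subr_gt0.
    apply: cvgM; first exact: (@gap_cvg (s, t)).
    by apply: cvgB; [exact: cvg_cst|exact: (@gap_cvg (s, t))].
  by move=> H; exact: (cvg_comp _ _ H (@continuous_real_complex R _)).
apply: cvg_trans F; apply: near_eq_cvg; near=> x.
have x1 : 0 < x.2 - x.1 by near: x; exact: (cvgr_gt _ (@gap_cvg (s, t)) _ st1).
have x2 : x.2 - x.1 < b - a by near: x; exact: (cvgr_lt _ (@gap_cvg (s, t)) _ st2).
rewrite /secant ifF; last by apply/negP => /eqP x12; move: x1; rewrite x12 subrr ltxx.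
by rewrite ifF //; apply/negP => /andP[/eqP xa /eqP xb]; move: x2; rewrite xa xb ltxx.
Unshelve. all: by end_near. Qed.

Lemma secant_neq0 x : K x -> secant x != 0.
Proof.
case: x => s t [/= a_s [st tb]]; rewrite /secant /=.
case: (eqVneq s t) => [_|st0]; first exact: D_neq0.
case: ifPn => [_|corner]; first by rewrite oppr_eq0 D_neq0.
have st1 : s < t by rewrite lt_neqAle st0.
have tsba : t - s < b - a.
  rewrite ltNge; apply: contra corner => h.
  by apply/andP; split; rewrite eq_le; apply/andP; split; lra.
rewrite mulf_neq0 //; last first.
  rewrite eq_complex /= eqxx andbT gt_eqF // divr_gt0 ?mulr_gt0 ?subr_gt0 //.
rewrite subr_eq0; apply/negP => /eqP gts; move: tb; rewrite le_eqVlt => /orP[/eqP tb|tb].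
  have : s = a.
    by apply: g_simple; rewrite ?lexx ?ab // ?g_closed -?tb // a_s; lra.
  by move=> sa; move: corner; rewrite sa tb !eqxx.
have ts : t = s by apply: g_simple => //; apply/andP; split; lra.
by move: st1; rewrite ts ltxx.
Qed.

(** The parity form of Hopf's Umlaufsatz. *)
Lemma tangent_sqrt_antiperiodic :
  exists2 c : R -> C, {within `[a, b], continuous c} &
    (forall s, a <= s <= b -> c s ^+ 2 = D s) /\ c b = - c a.
Proof.
have Kaa : K (a, a) by rewrite /triangle /= lexx ltW.
have [| f cf f2] := star_shaped_sqrt (@compact_triangle a b) Kaa _
  continuous_secant secant_neq0.
  move=> [s t] u [/= a_s [st tb]] /andP[u0 u1]; rewrite /triangle /= /GRing.scale /=.
  by split; [|split]; nra.
have pair_continuous (u v : R -> R) : continuous u -> continuous v ->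
    continuous (fun s => (u s, v s)).
  by move=> cu cv s; exact: (cvg_pair (cu s) (cv s)).
have id_continuous : continuous (fun s : R => s) by move=> s; exact: cvg_id.
have cst_continuous (k : R) : continuous (fun s : R => k) by move=> s; exact: cvg_cst.
have i_neq0 : 'i != 0 :> C by rewrite eq_complex /= oner_eq0 andbF.
have edge (h : R -> R * R) : continuous h -> (forall s, a <= s <= b -> K (h s)) ->
    {within `[a, b], continuous (f \o h)}.
  by move=> ch Kh; apply: within_continuous_compW cf => // s; rewrite /= in_itv; exact: Kh.
have cdiag : {within `[a, b], continuous (fun s => f (s, s))}.
  apply: (edge (fun s => (s, s))) => [|s /andP[? ?]]; last by split.
  by apply: pair_continuous.
have cleft : {within `[a, b], continuous (fun s => f (a, s))}.
  apply: (edge (fun s => (a, s))) => [|s /andP[? ?]]; last by split => /=.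
  by apply: pair_continuous.
have ctop : {within `[a, b], continuous (fun s => f (s, b))}.
  apply: (edge (fun s => (s, b))) => [|s /andP[? ?]]; last by split => /=.
  by apply: pair_continuous.
have f0 x : K x -> f x != 0.
  by move=> Kx; have := secant_neq0 Kx; rewrite -f2 // expf_eq0.
have Kleft s : a <= s <= b -> K (a, s) by move=> /andP[? ?]; split => /=.
have Ktop s : a <= s <= b -> K (s, b) by move=> /andP[? ?]; split => /=.
have opposite s : a <= s <= b -> secant (s, b) = - secant (a, s).
  move=> /andP[a_s sb]; rewrite /secant /= eqxx andbT (eq_sym a s).
  have [->|sa] := eqVneq s a; first by rewrite (lt_eqF ab).
  have [->|snb] := eqVneq s b; first by rewrite eqxx opprK D_closed.
  rewrite andbF g_closed -[RHS]mulNr (opprB (g s)).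
  by have -> : (b - s) * (b - a - (b - s)) = (s - a) * (b - a - (s - a)) by ring.
exists (fun s => f (s, s)); first exact: cdiag.
split.
  move=> s /andP[a_s sb]; rewrite f2; last by split.
  by rewrite /secant /= eqxx.
(* the quotient of the roots along the two legs has square 1, so it takes the
   same value at the two ends *)
have H : f (a, b) / ('i * f (a, a)) = f (b, b) / ('i * f (a, b)).
  apply: (@sign_constant a b (fun s => f (s, b) / ('i * f (a, s))) (ltW ab)).
  - apply/subspace_continuousP => s sab; move: sab; rewrite /= in_itv /= => sab.
    have /subspace_continuousP/(_ s) := cleft; rewrite /= in_itv => /(_ sab) cl.
    have /subspace_continuousP/(_ s) := ctop; rewrite /= in_itv => /(_ sab) ct.
    apply: cvgM; first exact: ct.
    apply: cvgV; last by apply: cvgM; [exact: cvg_cst|exact: cl].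
    by rewrite mulf_neq0 ?f0 ?i_neq0 //; exact: Kleft.
  - move=> s sab; rewrite expr_div_n exprMn !f2; [|exact: Kleft|exact: Ktop].
    rewrite opposite // sqr_i mulN1r divff // oppr_eq0 secant_neq0 //.
    exact: Kleft.
have Kab : K (a, b) by rewrite /triangle /= lexx ltW.
move/eqP: H; rewrite eqr_div ?mulf_neq0 ?f0 ?i_neq0 // => /eqP H.
have fab : f (a, b) ^+ 2 = - f (a, a) ^+ 2.
  by rewrite !f2 // /secant /= (lt_eqF ab) !eqxx.
have : 'i * f (a, a) * f (b, b) = 'i * f (a, a) * - f (a, a).
  rewrite [LHS]mulrC -H mulrCA -expr2 fab; ring.
by apply: mulfI; rewrite mulf_neq0 ?f0 ?i_neq0.
Qed.

End Secants.
End TurningNumber.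

(** * The Hamiltonian velocity is the zeta-derivative *)

Section HamiltonianTangent.
Variable R : realType.
Local Notation C := R[i].

Lemma real_complex_dnbhs : (real_complex R : R -> C) @ (0 : R)^' --> (0 : C)^'.
Proof.
move=> P /nbhs_normcP[e e0 eP].
suff: \forall t \near (0 : R)^', P t%:C by [].
near=> t; apply: eP.
  rewrite normc_distC subr0 (normcR t); near: t; apply: nbhs_dnbhs.
  by apply/nbhs_ballP; exists e => // u; rewrite -ball_normE /= sub0r normrN.
rewrite eq_complex /= eqxx andbT; near: t; exact: nbhs_dnbhs_neq.
Unshelve. all: by end_near. Qed.

(** The complex difference quotients along real increments are the real ones,
    because [p] is real on real points. *)
Lemma derive_real_point (p : C * C -> C) (X v : R * R) :
  (forall Y, Im (p (real_point Y)) = 0) -> differentiable p (real_point X) ->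
  'D_(real_point v) p (real_point X) = ('D_v (real_restriction p) X)%:C.
Proof.
move=> p_real dp.
have pE Y : p (real_point Y) = (real_restriction p Y)%:C.
  by rewrite /real_restriction; case: (p _) (p_real Y) => u w /= ->.
pose q (t : R) : R := t^-1 *: (real_restriction p (t *: v + X) - real_restriction p X).
have cq : (fun t => (q t)%:C) @ 0^' --> 'D_(real_point v) p (real_point X).
  have H : (fun h : C => h^-1 *: (p (h *: real_point v + real_point X) - p (real_point X)))
      @ 0^' --> 'D_(real_point v) p (real_point X).
    exact: (diff_derivable (v := real_point v) dp).
  have -> : (fun t => (q t)%:C) = (fun h : C =>
      h^-1 *: (p (h *: real_point v + real_point X) - p (real_point X))) \o real_complex R.
    apply/funext => t /=.
    have -> : t%:C *: real_point v + real_point X = real_point (t *: v + X).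
      by congr (_, _); rewrite /= rmorphD rmorphM.
    by rewrite !pE -rmorphB -fmorphV /= [LHS]rmorphM.
  exact: cvg_comp real_complex_dnbhs H.
have cRe := cvg_comp _ _ cq (@continuous_Re R _).
have cIm := cvg_comp _ _ cq (@continuous_Im R _).
have D0 : Im ('D_(real_point v) p (real_point X)) = 0.
  by apply: (cvg_unique _ cIm); [exact: norm_hausdorff|exact: cvg_cst].
have -> : 'D_v (real_restriction p) X = Re ('D_(real_point v) p (real_point X)).
  by apply: cvg_lim cRe; exact: norm_hausdorff.
by case: ('D_(real_point v) p _) D0 => u w /= ->.
Qed.

Lemma sqr_rsqrt2 : rsqrt2 R ^+ 2 = 2.
Proof. by rewrite -rmorphXn sqr_sqrtr // rmorph_nat. Qed.

Lemma kappa0_inv_linear (h : C) (w Z : C * C) :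
  kappa0_inv (h *: w + Z) = h *: kappa0_inv w + kappa0_inv Z.
Proof.
by congr (_, _); rewrite /= /GRing.scale /=; ring.
Qed.

Lemma kappa0K : cancel (@kappa0 R) (@kappa0_inv R).
Proof.
have E (x y : C) : ((x - 'i * y) / rsqrt2 R + 'i * ((y - 'i * x) / rsqrt2 R)) / rsqrt2 R = x.
  rewrite [X in X / _](_ : _ = (x - 'i ^+ 2 * x) / rsqrt2 R); last by ring.
  rewrite sqr_i mulN1r opprK -mulrA -invfM -expr2 sqr_rsqrt2.
  by apply: (canLR (mulfK _)); [rewrite pnatr_eq0|ring].
by case=> x y; congr (_, _); exact: E.
Qed.

Lemma proj_zE (X : R * R) :
  proj_z X = ((Num.sqrt 2)^-1 * X.1) +i* - ((Num.sqrt 2)^-1 * X.2).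
Proof.
rewrite /proj_z /= /rsqrt2 -fmorphV /=.
by apply/eqP; rewrite eq_complex /=; apply/andP; split; apply/eqP; ring.
Qed.

Lemma proj_z_inj : injective (@proj_z R).
Proof.
have s0 : (Num.sqrt 2 : R)^-1 != 0 by rewrite invr_eq0 gt_eqF // sqrtr_gt0.
move=> [x y] [x' y']; rewrite !proj_zE /= => -[/(mulfI s0)-> /oppr_inj].
by move/(mulfI s0) ->.
Qed.

Lemma kappa0_real_point (X : R * R) :
  kappa0 (real_point X) = (proj_z X, - 'i * (proj_z X)^*).
Proof.
congr (_, _); rewrite proj_zE /= /rsqrt2 -fmorphV /=.
by apply/eqP; rewrite eq_complex /=; apply/andP; split; apply/eqP; ring.
Qed.

(** The right-hand side is [dz/ds] for [z = (x - i xi) / sqrt 2] under the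
    Hamilton equations [dx/ds = d_xi p], [dxi/ds = - d_x p]. *)
Lemma dzeta_real_point (p : C * C -> C) (X : R * R) :
  (forall Y, Im (p (real_point Y)) = 0) -> differentiable p (real_point X) ->
  dzeta_p_Phi0 p (kappa0 (real_point X)) =
  ((Num.sqrt 2)^-1 * dxi p X) +i* ((Num.sqrt 2)^-1 * dx p X).
Proof.
move=> p_real dp; rewrite /dzeta_p_Phi0.
have -> : 'D_(0, 1) (p_Phi0 p) (kappa0 (real_point X)) =
    'D_(kappa0_inv (0, 1)) p (real_point X).
  rewrite /derive (_ : (fun h : C => h^-1 *: ((p_Phi0 p \o shift (kappa0 (real_point X)))
      (h *: (0, 1)) - p_Phi0 p (kappa0 (real_point X)))) =
    (fun h : C => h^-1 *: ((p \o shift (real_point X)) (h *: kappa0_inv (0, 1)) -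
      p (real_point X)))) //.
  by apply/funext => h /=; rewrite /p_Phi0 /shift /= kappa0_inv_linear kappa0K.
rewrite deriveE //.
have -> : kappa0_inv (0, 1) =
    ('i / rsqrt2 R) *: real_point (1, 0) + (rsqrt2 R)^-1 *: real_point (0, 1)
    :> C * C.
  by congr (_, _); rewrite /= /GRing.scale /=; ring.
have -> : 'd p (real_point X) (('i / rsqrt2 R) *: real_point (1, 0) +
      (rsqrt2 R)^-1 *: real_point (0, 1)) =
    'i / rsqrt2 R * 'D_(real_point (1, 0)) p (real_point X) +
    (rsqrt2 R)^-1 * 'D_(real_point (0, 1)) p (real_point X).
  by rewrite !deriveE // linearD !linearZ.
rewrite (derive_real_point _ p_real dp) (derive_real_point _ p_real dp).
rewrite /rsqrt2 -fmorphV /= /GRing.scale /=.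
by apply/eqP; rewrite eq_complex /=; apply/andP; split; apply/eqP; rewrite /dx /dxi; ring.
Qed.

End HamiltonianTangent.

(** * Products of classical analytic symbols *)

Section SymbolAlgebra.
Variables (R : realType) (V : normedModType R[i]).
Local Notation C := R[i].
Implicit Types (D : set V) (f g : V -> C).

Lemma holomorphic_onM D f g : holomorphic_on D f -> holomorphic_on D g ->
  holomorphic_on D (fun x => f x * g x).
Proof.
move=> [oD df] [_ dg]; split=> // x Dx.
exact: (differentiableM (df x Dx) (dg x Dx)).
Qed.

Lemma holomorphic_on_sum D n (f : 'I_n -> V -> C) : open D ->
  (forall i, holomorphic_on D (f i)) -> holomorphic_on D (fun x => \sum_(i < n) f i x).
Proof.
move=> oD df; split=> // x Dx.
have -> : (fun x => \sum_(i < n) f i x) = \sum_(i < n) f i.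
  by apply/funext => y; rewrite fct_sumE.
by apply: differentiable_sum => i; have [_] := df i; apply.
Qed.

Lemma holomorphic_on_cst D (c : C) : open D -> holomorphic_on D (fun=> c).
Proof. by move=> oD; split=> // x _; exact: differentiable_cst. Qed.

Lemma triangular_sum (A : pzRingType) (x y : nat -> A) N :
  \sum_(n < N) \sum_(k < n.+1) x k * y (n - k)%N =
  \sum_(k < N) x k * \sum_(i < N - k) y i.
Proof.
elim: N => [|N IH]; first by rewrite !big_ord0.
rewrite big_ord_recr /= IH [RHS]big_ord_recr /= subSnn big_ord1.
rewrite [\sum_(k < N.+1) _]big_ord_recr /= subnn addrA; congr (_ + _).
rewrite -big_split /=; apply: eq_bigr => k _.
by rewrite -mulrDr subSn 1?ltnW // big_ord_recr.
Qed.

Lemma expn_self_sub n k : (k <= n)%N -> (k ^ k * (n - k) ^ (n - k) <= n ^ n)%N.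
Proof.
move=> kn; rewrite -[X in (_ <= _ ^ X)%N](subnKC kn) expnD leq_mul //.
  by case: k kn => // k kn; rewrite leq_exp2r.
by case: (n - k)%N (leq_subr k n) => // j jn; rewrite leq_exp2r.
Qed.

Lemma normc_sum n (f : 'I_n -> C) : normc (\sum_(i < n) f i) <= \sum_(i < n) normc (f i).
Proof.
elim/big_ind2: _ => // [|x1 x2 y1 y2 h1 h2]; first by rewrite Normc.normc0.
by apply: le_trans (le_normcD _ _) _; exact: lerD.
Qed.

Lemma analytic_symbol1 h0 D : open D ->
  analytic_symbol h0 D (fun _ _ => 1) (fun n _ => (n == 0)%N%:R).
Proof.
move=> oD; split=> [h _|n|K _ _]; try exact: holomorphic_on_cst.
exists 1; split=> // [n x _|[|N] h x /andP[hp _] _].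
- by case: n => [|n]; rewrite ?Normc.normc1 ?Normc.normc0 ?expr1n ?mul1r ?exprn_ge0 // expr0.
- by rewrite big_ord0 subr0 Normc.normc1 !expr0 !mulr1.
- have -> : \sum_(n < N.+1) (h ^+ n)%:C * ((n : nat) == 0)%N%:R = 1 :> C.
    rewrite big_ord_recl big1 => [|i _]; last by rewrite mulr0.
    by rewrite addr0 expr0 mulr1.
  rewrite subrr Normc.normc0; apply: mulr_ge0; last exact: exprn_ge0.
  by apply: mulr_ge0; apply: exprn_ge0 => //; exact: ltW.
Qed.

(** If [M >= 1] bounds both symbols in the sense of the definition, each of the
    [n + 1] terms of the Cauchy product is at most [M^(n+2) n^n], because
    [k^k (n-k)^(n-k) <= n^n]; the constant [2 M^2] absorbs the number of terms.
    The remainder splits into the remainder of [a] times [b], and the terms of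
    [a] of order [k < N] times the remainder of [b] at order [N - k]: again
    [N + 1] terms of the same size. *)
Lemma analytic_symbolM h0 D (a b : R -> V -> C) (an bn : nat -> V -> C) :
  analytic_symbol h0 D a an -> analytic_symbol h0 D b bn ->
  analytic_symbol h0 D (fun h x => a h x * b h x)
    (fun n x => \sum_(k < n.+1) an k x * bn (n - k)%N x).
Proof.
move=> [ha han Ka] [hb hbn Kb]; split.
- by move=> h hh; apply: holomorphic_onM; [exact: ha|exact: hb].
- move=> n; have [oD _] := han 0%N.
  by apply: holomorphic_on_sum => // k; exact: holomorphic_onM.
move=> K cK KD; have [A [A0 anA aA]] := Ka K cK KD; have [B [B0 bnB bB]] := Kb K cK KD.
pose M := Num.max 1 (Num.max A B).
have M1 : 1 <= M by rewrite le_max lexx.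
have M0 : 0 < M by exact: lt_le_trans M1.
have AM : A <= M by rewrite !le_max lexx orbT.
have BM : B <= M by rewrite !le_max lexx !orbT.
have nn n : 0 <= (n%:R : R) ^+ n by rewrite exprn_ge0.
have powM (X : R) n : 0 < X -> X <= M -> X ^+ n.+1 * n%:R ^+ n <= M ^+ n.+1 * n%:R ^+ n.
  by move=> X0 XM; rewrite ler_wpM2r // lerXn2r // nnegrE ltW.
have {}anA n x : K x -> normc (an n x) <= M ^+ n.+1 * n%:R ^+ n.
  by move=> Kx; apply: le_trans (anA _ _ Kx) (powM _ _ A0 AM).
have {}bnB n x : K x -> normc (bn n x) <= M ^+ n.+1 * n%:R ^+ n.
  by move=> Kx; apply: le_trans (bnB _ _ Kx) (powM _ _ B0 BM).
have {}aA N h x : 0 < h < h0 -> K x ->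
    normc (a h x - \sum_(n < N) (h ^+ n)%:C * an n x) <= h ^+ N * (M ^+ N.+1 * N%:R ^+ N).
  move=> hh Kx; apply: le_trans (aA _ _ _ hh Kx) _; rewrite -mulrA ler_wpM2l ?powM //.
  by case/andP: hh => hp _; rewrite exprn_ge0 // ltW.
have {}bB N h x : 0 < h < h0 -> K x ->
    normc (b h x - \sum_(n < N) (h ^+ n)%:C * bn n x) <= h ^+ N * (M ^+ N.+1 * N%:R ^+ N).
  move=> hh Kx; apply: le_trans (bB _ _ _ hh Kx) _; rewrite -mulrA ler_wpM2l ?powM //.
  by case/andP: hh => hp _; rewrite exprn_ge0 // ltW.
have self n k : (k <= n)%N -> (k%:R : R) ^+ k * (n - k)%N%:R ^+ (n - k) <= n%:R ^+ n.
  by move=> kn; rewrite -!natrX -natrM ler_nat expn_self_sub.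
have prodM n k : (k <= n)%N -> (M ^+ k.+1 * k%:R ^+ k) *
    (M ^+ (n - k).+1 * (n - k)%N%:R ^+ (n - k)) <= M ^+ n.+2 * n%:R ^+ n.
  move=> kn; rewrite mulrACA -exprD addSn addnS subnKC // ler_wpM2l ?self //.
  by rewrite exprn_ge0 // ltW.
have total n : M ^+ n.+2 * n%:R ^+ n *+ n.+1 <= (2 * M ^+ 2) ^+ n.+1 * n%:R ^+ n.
  rewrite -mulrnAl ler_wpM2r // exprMn -exprM -[leLHS]mulr_natl ler_pM //.
  + by rewrite exprn_ge0 // ltW.
  + by rewrite -natrX ler_nat ltnW // ltn_expl.
  + by rewrite ler_weXn2l // mul2n -addnn addnS ltnS leq_addr.
exists (2 * M ^+ 2); split.
- by rewrite mulr_gt0 // exprn_gt0.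
- move=> n x Kx; apply: le_trans (normc_sum _) _; apply: (le_trans _ (total n)).
  rewrite -[X in _ <= _ *+ X](card_ord n.+1) -sumr_const; apply: ler_sum => k _.
  rewrite Normc.normcM; apply: (le_trans _ (prodM n k _)); last by rewrite -ltnS.
  by apply: ler_pM; rewrite ?normc_ge0 ?anA ?bnB.
- move=> N h x hh Kx; have hp : 0 < h by case/andP: hh.
  have -> : a h x * b h x -
      \sum_(n < N) (h ^+ n)%:C * (\sum_(k < n.+1) an k x * bn (n - k)%N x) =
    (a h x - \sum_(n < N) (h ^+ n)%:C * an n x) * b h x +
    \sum_(k < N) (h ^+ k)%:C * an k x *
      (b h x - \sum_(i < N - k) (h ^+ i)%:C * bn i x).
    have -> : \sum_(n < N) (h ^+ n)%:C * (\sum_(k < n.+1) an k x * bn (n - k)%N x) =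
      \sum_(n < N) \sum_(k < n.+1)
        ((h ^+ k)%:C * an k x) * ((h ^+ (n - k))%:C * bn (n - k)%N x).
      apply: eq_bigr => n _; rewrite mulr_sumr; apply: eq_bigr => k _.
      by rewrite mulrACA -rmorphM -exprD subnKC // -ltnS.
    rewrite (triangular_sum (fun k => (h ^+ k)%:C * an k x) (fun k => (h ^+ k)%:C * bn k x)).
    under [X in _ = _ + X]eq_bigr do rewrite mulrBr.
    by rewrite sumrB -mulr_suml mulrBl addrA subrK.
  apply: le_trans (le_normcD _ _) _; rewrite Normc.normcM.
  have b0 : normc (b h x) <= M.
    by have := bB 0%N _ _ hh Kx; rewrite big_ord0 subr0 expr0 mul1r expr1 mulr1.
  have first : normc (a h x - \sum_(n < N) (h ^+ n)%:C * an n x) * normc (b h x) <=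
      h ^+ N * (M ^+ N.+2 * N%:R ^+ N).
    apply: le_trans (ler_pM (normc_ge0 _) (normc_ge0 _) (aA _ _ _ hh Kx) b0) _.
    by rewrite le_eqVlt; apply/orP; left; rewrite [M ^+ N.+2]exprSr; apply/eqP; ring.
  have rest : normc (\sum_(k < N) (h ^+ k)%:C * an k x *
      (b h x - \sum_(i < N - k) (h ^+ i)%:C * bn i x)) <= (h ^+ N * (M ^+ N.+2 * N%:R ^+ N)) *+ N.
    apply: le_trans (normc_sum _) _.
    rewrite -[X in _ <= _ *+ X](card_ord N) -sumr_const; apply: ler_sum => k _.
    have hk : 0 <= h ^+ k by rewrite exprn_ge0 // ltW.
    have kN : (k <= N)%N by exact: ltnW.
    rewrite Normc.normcM Normc.normcM normcR ger0_norm //.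
    have s1 := ler_wpM2l hk (anA k x Kx); have s2 := bB (N - k)%N _ _ hh Kx.
    apply: (le_trans (ler_pM (mulr_ge0 hk (normc_ge0 _)) (normc_ge0 _) s1 s2)).
    rewrite mulrACA -exprD subnKC // ler_wpM2l ?prodM // exprn_ge0 // ltW //.
  apply: le_trans (lerD first rest) _; rewrite -mulrS -mulrnAr -mulrA ler_wpM2l ?total //.
  by rewrite exprn_ge0 // ltW.
Qed.

Lemma analytic_symbol_prod h0 D (I : Type) (r : seq I) (a : I -> R -> V -> C)
    (an : I -> nat -> V -> C) : open D -> (forall i, analytic_symbol h0 D (a i) (an i)) ->
  exists2 bn, analytic_symbol h0 D (fun h x => \prod_(i <- r) a i h x) bn &
    forall x, bn 0%N x = \prod_(i <- r) an i 0%N x.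
Proof.
move=> oD ha; elim: r => [|i r [bn hb bn0]].
  exists (fun n _ => (n == 0)%N%:R) => [|x]; last by rewrite big_nil.
  by under eq_fun do under eq_fun do rewrite big_nil; exact: analytic_symbol1.
exists (fun n x => \sum_(k < n.+1) an i k x * bn (n - k)%N x) => [|x].
  under eq_fun do under eq_fun do rewrite big_cons.
  exact: analytic_symbolM.
by rewrite big_ord1 subnn bn0 big_cons.
Qed.

Lemma analytic_symbol_principal h0 D (a : R -> V -> C) (an : nat -> V -> C) (K : set V) :
  analytic_symbol h0 D a an -> compact K -> K `<=` D ->
  exists2 A, 0 < A & forall h x, 0 < h < h0 -> K x -> normc (a h x - an 0%N x) <= A * h.
Proof.
move=> [_ _ aK] cK KD; have [A [A0 _ aA]] := aK K cK KD.
exists (A ^+ 2); first by rewrite exprn_gt0.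
move=> h x hh Kx; have := aA 1%N h x hh Kx.
by rewrite big_ord1 expr0 mul1r !expr1 mulr1 mulrC.
Qed.

End SymbolAlgebra.

(** * Limits of symbols and transition signs *)

Section Transition.
Variable R : realType.
Local Notation C := R[i].

Lemma holomorphic_slice_continuous (V W : normedModType C) (D : set (V * W))
    (f : V * W -> C) (l : V) (z : W) : holomorphic_on D f -> D (l, z) ->
  {for z, continuous (fun w => f (l, w))}.
Proof.
move=> [_ df] Dlz; have /= dz := differentiable_continuous (df _ Dlz).
have cl : l @[_ --> z] --> l by exact: cvg_cst.
have cz : w @[w --> z] --> z by exact: cvg_id.
exact: (cvg_comp _ f (cvg_pair cl cz) dz).
Qed.

Lemma analytic_symbolS (V : normedModType C) h0 (D W : set V) (a : R -> V -> C) an :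
  open W -> W `<=` D -> analytic_symbol h0 D a an -> analytic_symbol h0 W a an.
Proof.
move=> oW WD [ha han Ka]; split.
- by move=> h /ha[_ da]; split=> // x /WD; exact: da.
- by move=> n; have [_ da] := han n; split=> // x /WD; exact: da.
- by move=> K cK /subset_trans/(_ WD); exact: Ka.
Qed.

Lemma analytic_symbol_cvg (V : normedModType C) h0 (D : set V) (a : R -> V -> C) an x :
  0 < h0 -> D x -> analytic_symbol h0 D a an -> a h x @[h --> 0^'+] --> an 0%N x.
Proof.
move=> h0p Dx ha.
have [|A A0 aA] := @analytic_symbol_principal _ _ _ _ _ _ [set x] ha (@compact_set1 _ x).
  by move=> _ ->.
apply/cvgcP => e e0; near=> h.
have hp : 0 < h by near: h; exact: nbhs_right_gt.
have hh0 : h < h0 by near: h; exact: nbhs_right_lt.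
rewrite normc_distC; apply: le_lt_trans (aA h x _ erefl) _; first by rewrite hp hh0.
rewrite mulrC -ltr_pdivlMr //; near: h; apply: nbhs_right_lt; exact: divr_gt0.
Unshelve. all: by end_near. Qed.

Lemma exp_small_cvg (f : R -> C) (h0 A c : R) : 0 < h0 -> 0 < A -> 0 < c ->
  (forall h, 0 < h < h0 -> normc (f h) <= A * expR (- c / h)) -> f @ 0^'+ --> (0 : C).
Proof.
move=> h0p A0 c0 fA; apply/cvgcP => e e0; near=> h.
have hp : 0 < h by near: h; exact: nbhs_right_gt.
have hh0 : h < h0 by near: h; exact: nbhs_right_lt.
rewrite sub0r normcN; apply: le_lt_trans (fA h _) _; first by rewrite hp.
have small : expR (- c / h) <= h / c.
  rewrite mulNr expRN -[leRHS]invrK lef_pV2 ?posrE ?expR_gt0 ?invr_gt0 ?divr_gt0 //.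
  rewrite invf_div; apply: le_trans (expR_ge1Dx _); by rewrite lerDr.
apply: le_lt_trans (ler_wpM2l (ltW A0) small) _.
rewrite mulrA mulrAC -ltr_pdivlMl ?divr_gt0 //.
near: h; apply: nbhs_right_lt; by rewrite mulr_gt0 ?invr_gt0 ?divr_gt0.
Unshelve. all: by end_near. Qed.

(** An exponentially small error is invisible in the limit [h -> 0], in which
    only the principal symbols survive. *)
Lemma principal_transition (V W : normedModType C) h0 (L : set W) (D D' : set V) 
    (al : R -> W -> C) (a a' : R -> W * V -> C) aln an an' (l : W) (z : V) (A c : R) :
  0 < h0 -> 0 < A -> 0 < c -> L l -> D z -> D' z ->
  analytic_symbol h0 L al aln -> analytic_symbol h0 (L `*` D) a an ->
  analytic_symbol h0 (L `*` D') a' an' ->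
  (forall h, 0 < h < h0 -> normc (al h l * a' h (l, z) - a h (l, z)) <= A * expR (- c / h)) ->
  aln 0%N l * an' 0%N (l, z) = an 0%N (l, z).
Proof.
move=> h0p A0 c0 Ll Dz D'z hal ha ha' glue.
have c1 := analytic_symbol_cvg h0p Ll hal.
have c2 : a h (l, z) @[h --> 0^'+] --> an 0%N (l, z).
  by apply: analytic_symbol_cvg ha => //; split.
have c3 : a' h (l, z) @[h --> 0^'+] --> an' 0%N (l, z).
  by apply: analytic_symbol_cvg ha' => //; split.
have := exp_small_cvg h0p A0 c0 glue.
move/(cvg_unique (@norm_hausdorff _ _) (cvgB (cvgM c1 c3) c2)).
by move/eqP; rewrite subr_eq0 => /eqP.
Qed.

(** Multiplying the relations over all [j], the factors [u] cancel since the
    cyclic successor permutes the indices; the only other contribution is the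
    sign at the index where the cycle closes. *)
Lemma prod_cyclic (m : nat) (x u : 'I_m.+1 -> C) :
  (forall j, u j != 0) ->
  (forall j, u j = x j * (if j == ord_max then -1 else 1) * u (ordS j)) ->
  \prod_j x j = -1.
Proof.
move=> u0 ux.
have pu : \prod_j u (ordS j) = \prod_j u j.
  by rewrite [RHS](reindex (@ordS m.+1)) //; exact: onW_bij (ordS_bij _).
have ps : \prod_(j < m.+1) (if j == ord_max then -1 else 1 : C) = -1.
  rewrite (bigD1 ord_max) //= eqxx big1 ?mulr1 // => j /negbTE -> //.
have pu0 : \prod_j u j != 0 by apply/prodf_neq0 => j _; exact: u0.
have : \prod_j u j = \prod_j x j * -1 * \prod_j u j.
  rewrite -[X in _ * X * _]ps -[X in _ * X]pu -!big_split /=; exact: eq_bigr.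
rewrite -[LHS]mul1r => /(mulIf pu0); rewrite mulrN1 => H.
by apply: oppr_inj; rewrite opprK -H.
Qed.

End Transition.

(** * Monodromy of the amplitudes along the curve *)

Section Monodromy.
Variable R : realType.
Local Notation C := R[i].

(** On each disc the product of a continuous square root [c] of the velocity [D]
    and of the square root [b j] of [D^-1] has square 1, so it is constant on
    the arc inside that disc. The values on consecutive arcs differ by the
    transition sign [x j], except that closing the curve brings in the extra
    sign from [c (t m.+1) = - c (t 0)]. *)
Lemma inverse_tangent_sqrt_monodromy (m : nat) (gam D : R -> C) (t : nat -> R)
    (B : 'I_m.+1 -> set C) (b : 'I_m.+1 -> C -> C) (x : 'I_m.+1 -> C) :
  (forall s : R, is_derive s 1 (fun s => Re (gam s)) (Re (D s))) ->
  (forall s : R, is_derive s 1 (fun s => Im (gam s)) (Im (D s))) ->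
  (forall s, D s != 0) ->
  gam (t 0%N) = gam (t m.+1) -> D (t 0%N) = D (t m.+1) ->
  (forall s s', t 0%N <= s < t m.+1 -> t 0%N <= s' < t m.+1 ->
    gam s = gam s' -> s = s') ->
  (forall j, open (B j)) -> (forall s, exists j, B j (gam s)) ->
  (forall j : 'I_m.+1, t j < t j.+1) ->
  (forall (j : 'I_m.+1) s, t j <= s <= t j.+1 -> B j (gam s)) ->
  (forall j z, B j z -> {for z, continuous (b j)}) ->
  (forall j s, B j (gam s) -> b j (gam s) ^+ 2 = (D s)^-1) ->
  (forall j z, B j z -> B (ordS j) z -> x j * b (ordS j) z = b j z) ->
  \prod_j x j = -1.
Proof.
move=> dRe dIm D_neq0 gam_per D_per gam_inj oB B_of t_lt gam_B cb b_sqr trans.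
have cgam : continuous gam := continuous_curve dRe dIm.
have cbg j s : B j (gam s) -> b j (gam u) @[u --> s] --> b j (gam s).
  move=> Bs; exact: (cvg_comp _ _ (cgam s) (cb _ _ Bs)).
(* [D] is locally the inverse of the square of a continuous amplitude *)
have cD : continuous D.
  move=> s; have [j Bs] := B_of s.
  have near_B : \forall u \near s, B j (gam u).
    exact: (cgam s _ (open_nbhs_nbhs (conj (oB j) Bs))).
  have bD u : B j (gam u) -> (b j (gam u) * b j (gam u))^-1 = D u.
    by move=> /b_sqr; rewrite -expr2 => ->; rewrite invrK.
  have : (b j (gam u) * b j (gam u))^-1 @[u --> s] --> (b j (gam s) * b j (gam s))^-1.
    apply: cvgV; last by apply: cvgM; exact: cbg.
    by rewrite -expr2 (b_sqr _ _ Bs) invr_eq0.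
  rewrite (bD _ Bs); apply: cvg_trans; apply: near_eq_cvg.
  by near=> u; rewrite bD //; near: u.
have t_le (i j : nat) : (i <= j <= m.+1)%N -> t i <= t j.
  move=> /andP[/subnKC <-]; elim: (j - i)%N => [|k IH]; rewrite ?addn0 // addnS => km.
  exact: le_trans (IH (ltnW km)) (ltW (t_lt (Ordinal km))).
have ab : t 0%N < t m.+1.
  by apply: (lt_le_trans (t_lt ord0)); apply: t_le; rewrite leqnn.
have [c cc [c2 c_anti]] :=
  tangent_sqrt_antiperiodic ab dRe dIm cD D_neq0 gam_per D_per gam_inj.
pose f j s := c s * b j (gam s).
have f_sqr j s : t 0%N <= s <= t m.+1 -> B j (gam s) -> f j s ^+ 2 = 1.
  by move=> ts Bs; rewrite exprMn c2 // b_sqr // divff.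
have sub_itv (j : 'I_m.+1) s : t j <= s <= t j.+1 -> t 0%N <= s <= t m.+1.
  move=> /andP[js sj]; have h1 : t 0%N <= t j by apply: t_le; rewrite /= ltnW.
  have h2 : t j.+1 <= t m.+1 by apply: t_le; rewrite leqnn andbT.
  by rewrite (le_trans h1 js) (le_trans sj h2).
have f_cst (j : 'I_m.+1) : f j (t j) = f j (t j.+1).
  apply: sign_constant; first by rewrite ltW // t_lt.
    apply/subspace_continuousP => s; rewrite /= in_itv /= => ts.
    have cs : {within `[t j, t j.+1], continuous c}.
      apply: continuous_subspaceW cc => u; rewrite /= !in_itv /=; exact: sub_itv.
    have /subspace_continuousP/(_ s) := cs; rewrite /= in_itv /= => /(_ ts) cts.
    apply: (cvgM cts); apply: cvg_within_filter; apply: cbg; exact: gam_B.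
  by move=> s ts; apply: f_sqr; [exact: sub_itv ts|exact: gam_B].
have tj (j : 'I_m.+1) : t j <= t j <= t j.+1 by rewrite lexx ltW.
have tj1 (j : 'I_m.+1) : t j <= t j.+1 <= t j.+1 by rewrite lexx ltW.
apply: (@prod_cyclic _ _ x (fun j => f j (t j))) => j.
  have := f_sqr j _ (sub_itv _ _ (tj j)) (gam_B _ _ (tj j)).
  by apply: contra_eq_neq => ->; rewrite expr0n /= eq_sym oner_eq0.
have := trans j _ (gam_B _ _ (tj1 j)); rewrite f_cst /f.
have [->|jm] := eqVneq j ord_max.
  have S0 : ordS (@ord_max m) = ord0 by apply: val_inj; rewrite /= modnn.
  rewrite S0 /= -gam_per => /(_ (gam_B ord0 _ (tj ord0))) <-.
  by rewrite c_anti; ring.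
have jm' : (j < m)%N.
  by rewrite ltn_neqAle -ltnS ltn_ord andbT; apply: contra jm => /eqP E; apply/eqP/val_inj.
have Sj : ordS j = j.+1 :> nat by rewrite /= modn_small.
rewrite -[j.+1]Sj => /(_ (gam_B _ _ (tj (ordS j)))) <-.
by rewrite mulr1 mulrCA.
Unshelve. all: by end_near. Qed.

End Monodromy.

(** * The product of the transition symbols *)

Theorem proposition4p17 (R : realType)
  (frakm : R * R -> R) (U0 : set (R[i] * R[i])) (p : R[i] * R[i] -> R[i])
  (E1 E2 delta : R)
  (Hp : standing_assumptions frakm U0 p E1 E2 delta)
  (lam0 : R) (Hlam0 : E1 - delta < lam0 < E2 + delta)
  (L V : set R[i]) (zeta : R[i] * R[i] -> R[i])
  (Hzeta : eikonal_solution p U0 lam0 L V zeta)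
  (m : nat) (ctr : 'I_m.+1 -> R[i]) (rad : 'I_m.+1 -> R)
  (B := fun j => disc (ctr j) (rad j))
  (Hcover : cyclic_cover p lam0 ctr rad)
  (HBV : forall j, B j `<=` V)
  (Omega : set R[i]) (K : 'I_m.+1 -> set R[i])
  (HK : inner_sets p lam0 B Omega K)
  (h0 : R) (Hh0 : 0 < h0)
  (N : set R) (M : R) (HN : nbhs lam0 N) (HM : 0 < M)
  (HSigma : forall h, 0 < h < h0 -> Sigma N M h `<=` L)
  (I : set R) (HNI : N `<=` I)
  (zb : 'I_m.+1 -> R -> R[i])
  (Hzb_smooth : forall j, smooth_curve_on I (zb j))
  (Hzb : forall j lam, I lam -> (curve p lam `&` B j) (zb j lam))
  (a : 'I_m.+1 -> R -> R[i] * R[i] -> R[i])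
  (an : 'I_m.+1 -> nat -> R[i] * R[i] -> R[i])
  (Ha : forall j, analytic_symbol h0 (L `*` B j) (a j) (an j))
  (Ha0 : forall j l z, L l -> B j z ->
     an j 0%N (l, z) ^+ 2 = (dzeta_p_Phi0 p (z, zeta (l, z)))^-1)
  (Hwkb : forall j, quasimode p h0 N M (K j) (B j)
     (wkb (a j) (phase zeta (zb j))))
  (alpha : 'I_m.+1 -> R -> R[i] -> R[i])
  (alphan : 'I_m.+1 -> nat -> R[i] -> R[i])
  (Halpha : forall j, analytic_symbol h0 L (alpha j) (alphan j))
  (Halpha0 : forall j, (forall l, L l -> alphan j 0%N l = 1) \/
                       (forall l, L l -> alphan j 0%N l = -1))
  (Hglue : forall j, exists A CC : R, [/\ 0 < A, 0 < CC &
     \forall l \near lam0%:C, forall h z, 0 < h < h0 ->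
       (B j `&` B (ordS j)) z ->
       normc (alpha j h l * a (ordS j) h (l, z) - a j h (l, z))
         <= A * expR (- CC / h)])
  (mu := fun (h : R) (l : R[i]) => \prod_(j < m.+1) alpha j h l) :
  exists W : set R[i],
    [/\ W lam0%:C,
        exists mun : nat -> R[i] -> R[i], analytic_symbol h0 W mu mun
      & exists A : R, 0 < A /\ forall h l, 0 < h < h0 -> W l ->
          normc (mu h l - (-1)) <= A * h].

Proof.
have [Lopen Llam0] := es_L Hzeta.
have p_real := sa_real Hp.
have dp X : differentiable p (real_point X).
  by apply: (sa_holo Hp).2; have [_ + _ _] := sa_tube Hp; apply.
have [g [t [g_level dg g_per g_inj g_B]]] := cc_flow Hcover.
pose gam s := proj_z (g s).
pose D s := dzeta_p_Phi0 p (kappa0 (real_point (g s))).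
have gam_curve s : curve p lam0 (gam s) by exists (g s).
have DE s : D s = ((Num.sqrt 2)^-1 * dxi p (g s)) +i* ((Num.sqrt 2)^-1 * dx p (g s)).
  exact: dzeta_real_point.
have Dzeta s : D s = dzeta_p_Phi0 p (gam s, zeta (lam0%:C, gam s)).
  by rewrite (es_init Hzeta (gam_curve s)) /D kappa0_real_point.
have dRe s : is_derive (s : R) 1 (fun s => Re (gam s)) (Re (D s)).
  rewrite DE /= (_ : (fun s => Re (gam s)) = (Num.sqrt 2)^-1 \*: (fun s => (g s).1)).
    by apply: is_deriveZ; have [] := dg s.
  by apply/funext => u; rewrite /gam proj_zE.
have dIm s : is_derive (s : R) 1 (fun s => Im (gam s)) (Im (D s)).
  rewrite DE /= (_ : (fun s => Im (gam s)) = - (Num.sqrt 2)^-1 \*: (fun s => (g s).2)).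
    rewrite (_ : (Num.sqrt 2)^-1 * _ = - (Num.sqrt 2)^-1 *: (- dx p (g s))).
      by apply: is_deriveZ; have [] := dg s.
    by rewrite /GRing.scale /= mulrNN.
  by apply/funext => u; rewrite /gam proj_zE /= /GRing.scale /= mulNr.
have B_of s : exists j, B j (gam s) by have [j _ ?] := cc_cover Hcover (gam_curve s); exists j.
have D_neq0 s : D s != 0.
  by have [j Bs] := B_of s; rewrite Dzeta; apply: (es_nondeg Hzeta Llam0); exact: (HBV j).
have oB j : open (B j) by apply: ball_open; rewrite ltcR; exact: (cc_rad Hcover).
pose b j z := an j 0%N (lam0%:C, z).
have cb j z : B j z -> {for z, continuous (b j)}.
  move=> Bz; have [_ /(_ 0%N) han _] := Ha j.
  exact: holomorphic_slice_continuous han (conj Llam0 Bz).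
have b_sqr j s : B j (gam s) -> b j (gam s) ^+ 2 = (D s)^-1.
  by move=> Bs; rewrite (Ha0 _ _ _ Llam0 Bs) Dzeta.
have t_lt (j : 'I_m.+1) : t j < t j.+1 by have [] := g_B j.
have gam_B (j : 'I_m.+1) s : t j <= s <= t j.+1 -> B j (gam s).
  by move=> ts; have [_] := g_B j; apply.
have gam_per : gam (t 0%N) = gam (t m.+1) by rewrite /gam g_per.
have D_per : D (t 0%N) = D (t m.+1) by rewrite /D g_per.
have gam_inj s s' : t 0%N <= s < t m.+1 -> t 0%N <= s' < t m.+1 -> gam s = gam s' -> s = s'.
  by move=> ts ts' /proj_z_inj; exact: g_inj.
pose x j := alphan j 0%N lam0%:C.
have trans j z : B j z -> B (ordS j) z -> x j * b (ordS j) z = b j z.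
  move=> Bz BSz; have [A [cst [A0 cst0 /nbhs_singleton glue]]] := Hglue j.
  apply: (principal_transition Hh0 A0 cst0 Llam0 Bz BSz (Halpha j) (Ha j) (Ha (ordS j))).
  by move=> h hh; exact: glue.
have prod_x : \prod_j x j = -1.
  exact: (inverse_tangent_sqrt_monodromy dRe dIm D_neq0 gam_per D_per gam_inj oB B_of
    t_lt gam_B cb b_sqr trans).
have [K0 [K0c K0n K0L]] := compact_nbhs_complex (open_nbhs_nbhs (conj Lopen Llam0)).
have [mun hmu mu0] := analytic_symbol_prod (index_enum 'I_m.+1) Lopen Halpha.
exists K0°; split.
- exact: K0n.
- exists mun; apply: analytic_symbolS hmu; first exact: open_interior.
  by apply: subset_trans K0L; exact: interior_subset.
- have [A A0 muA] := analytic_symbol_principal hmu K0c K0L.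
  exists A; split; first exact: A0.
  move=> h l hh Wl; have Kl := interior_subset Wl.
  have <- : mun 0%N l = -1; last exact: muA.
  rewrite mu0 -prod_x; apply: eq_bigr => j _.
  by have [E|E] := Halpha0 j; rewrite /x (E _ Llam0) (E _ (K0L _ Kl)).
Qed.
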